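(* Let $G$ be a group with a finitely generated abelian normal subgroup $N$. Suppose $G/N$ is an abelian, $\ell_0$-generated group of torsion-free rank $\ell$. Choose a generating set $g_1,\ldots,g_{\ell_0}$ of $G/N$, so that $N$ becomes a module over $R=\mathbb{Z}[x_1,\ldots,x_{\ell_0}]$, with $x_i$ acting on $N$ as $g_i$ does by conjugation. Let $I=(x_1-1,x_2-1,\ldots,x_{\ell_0}-1)$ be the ideal of $R$ generated by the elements $x_i-1$. Let $t$ be the torsion-free rank of the abelian group $N/IN$, and let $d=d_{\mathbb{Q}\otimes_{\mathbb{Z}}R}(\mathbb{Q}\otimes_{\mathbb{Z}}N)$ be the minimal number of generators of $\mathbb{Q}\otimes_{\mathbb{Z}}N$ as a $\mathbb{Q}\otimes_{\mathbb{Z}}R$-module. Then $$\operatorname{mdeg}(G)\le\max\{\ell+t-1,\,d\},$$ with equality if both $G\cong N\rtimes G/N$ and $\ell\ge 1$.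
   Context: For a finitely generated group $G$, $m_n(G)$ denotes the number of maximal subgroups of $G$ of index $n$, and $\operatorname{mdeg}(G)=\inf\{\alpha : m_n(G)\le n^\alpha \text{ for all large } n\}=\limsup_{n\to\infty}\frac{\log m_n(G)}{\log n}$. Since $N$ is abelian, the conjugation action of $G$ on $N$ induces an action of $G/N$ on $N$. The condition $G\cong N\rtimes G/N$ means that the extension $N\hookrightarrow G\twoheadrightarrow G/N$ splits. *)

(* Defs.v *)
From HB Require Import structures.
From mathcomp Require Import all_boot all_order all_algebra.
From mathcomp Require Import finmap boolp classical_sets functions cardinality.
From mathcomp Require Import reals ereal topology normedtype sequences exp.
(* The notations of multinomials clash with those of analysis: mpoly l A is
   A[X_1, ..., X_l], with variables mpolyX A (mnm1 i). *)
From mathcomp Require Import -(notations) ssrcomplements freeg mpoly.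

Set Implicit Arguments.
Unset Strict Implicit.
Unset Printing Implicit Defensive.

Import Order.TTheory GRing.Theory Num.Theory.
Local Open Scope classical_set_scope.
Local Open Scope ring_scope.
Local Open Scope quotient_scope.
Local Open Scope card_scope.

Section Submodules.
Variables (R : pzRingType) (M : lmodType R).

Definition is_submod (W : set M) :=
  W 0 /\ forall (a : R) (x y : M), W x -> W y -> W (a *: x + y).

Definition submod_span (S : set M) : set M := smallest is_submod S.

Lemma span_submod S : is_submod (submod_span S).
Proof.
split=> [W [[W0 _] _]|a x y Sx Sy W WS] //.
by have [[_ WD] _] := WS; apply: WD; [apply: Sx | apply: Sy].
Qed.

Lemma sub_span S : S `<=` submod_span S.
Proof. by move=> x Sx W [_]; apply. Qed.

Definition span_pred (S : set M) : {pred M} := fun x => `[< submod_span S x >].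

Lemma span_zmod_closed S : zmod_closed (span_pred S).
Proof.
have [S0 SD] := span_submod S; split=> [|x y /asboolP Sx /asboolP Sy].
  exact/asboolP.
by apply/asboolP; rewrite addrC -scaleN1r; apply: SD.
Qed.

HB.instance Definition _ S :=
  GRing.isZmodClosed.Build M (span_pred S) (span_zmod_closed S).

(* The additive group of M modulo the submodule generated by S. *)
Definition quotm (S : set M) : Type := Quotient.quot (span_pred S).

HB.instance Definition _ S := GRing.Zmodule.on (quotm S).

Definition is_min_gens (k : nat) :=
  (exists v : 'I_k -> M, submod_span (range v) = setT) /\
  (forall j (v : 'I_j -> M), submod_span (range v) = setT -> (k <= j)%N).

Definition mul_ideal (I : set R) : set M :=
  submod_span [set x | exists a m, I a /\ x = a *: m].

End Submodules.
Arguments mul_ideal {R} M I.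
Arguments is_min_gens {R} M k.

(* The torsion-free rank of an abelian group is the largest cardinality of a
   Z-linearly independent family. *)
Definition Zfree (A : zmodType) k (v : 'I_k -> A) :=
  forall c : 'I_k -> int, \sum_i v i *~ c i = 0 -> forall i, c i = 0.

Definition is_tf_rank (A : zmodType) (r : nat) :=
  (exists v : 'I_r -> A, Zfree v) /\
  (forall k (v : 'I_k -> A), Zfree v -> (k <= r)%N).

Section Tensor.
Variables (A : nzRingType) (V : zmodType).

(* The free abelian group on A * V, with basis tens_gen a v. *)
Definition tens_free := FreegDefs.type_of (Phant int) (Phant (A * V)%type).
HB.instance Definition _ := GRing.Lmodule.on tens_free.

Definition tens_gen (a : A) (v : V) : tens_free := Freeg [:: (1, (a, v))].

(* Z-balancedness follows from biadditivity. *)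
Definition tens_rels : set tens_free :=
  [set r | (exists a b v,
             r = tens_gen (a + b) v - (tens_gen a v + tens_gen b v)) \/
           (exists a v w,
             r = tens_gen a (v + w) - (tens_gen a v + tens_gen a w))].

(* A tensored with V over Z, with its structure of left A-module. *)
Definition tensor : Type := quotm tens_rels.
HB.instance Definition _ := GRing.Zmodule.on tensor.

Definition tens (a : A) (v : V) : tensor :=
  \pi_(Quotient.quot (span_pred tens_rels)) (tens_gen a v).

Local Notation Q := (Quotient.quot (span_pred tens_rels)).

Let tens_rel r : tens_rels r -> \pi_Q r = 0.
Proof.
move=> rS; rewrite -[0](raddf0 \pi_Q); apply/eqP.
have := Quotient.idealrBE (span_pred tens_rels) r 0.
rewrite subr0 => <-; apply/asboolP.
exact: sub_span.
Qed.

Lemma tensDl a b v : tens (a + b) v = tens a v + tens b v.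
Proof.
apply/eqP; rewrite /tens -subr_eq0 -raddfD -raddfB /=; apply/eqP/tens_rel.
by left; exists a, b, v.
Qed.

Lemma tensDr a v w : tens a (v + w) = tens a v + tens a w.
Proof.
apply/eqP; rewrite /tens -subr_eq0 -raddfD -raddfB /=; apply/eqP/tens_rel.
by right; exists a, v, w.
Qed.


Section Lift.
Variables (W : zmodType) (f : A -> V -> W).

Definition tens_lift (t : tensor) : W :=
  fglift (fun av => f av.1 av.2 : zmodule W) (repr t).

Hypothesis fDl : forall a b v, f (a + b) v = f a v + f b v.
Hypothesis fDr : forall a v w, f a (v + w) = f a v + f a w.

Let F : tens_free -> W := fglift (fun av => f av.1 av.2 : zmodule W).

Let FB x y : F (x - y) = F x - F y.
Proof. exact: (@lift_is_additive _ _ (zmodule W)). Qed.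

Let F0 : F 0 = 0. Proof. by have := FB 0 0; rewrite !subrr. Qed.
Let FN x : F (- x) = - F x. Proof. by rewrite -[- x]sub0r FB F0 sub0r. Qed.
Let FD x y : F (x + y) = F x + F y.
Proof. by rewrite -{1}(opprK y) FB FN opprK. Qed.
Let FZ n x : F (n *: x) = F x *~ n.
Proof.
elim/int_ind: n => [|n IH|n IH]; rewrite ?scale0r ?F0 //.
  by rewrite intS scalerDl scale1r FD IH mulrzDr.
by rewrite intS opprD scalerDl scaleN1r FD FN IH mulrzDr mulrN1z.
Qed.
Let Fgen a v : F (tens_gen a v) = f a v.
Proof. by rewrite /F liftU scale1r. Qed.

Let F_rels r : submod_span tens_rels r -> F r = 0.
Proof.
apply: (@smallest_sub _ _ _ [set r | F r = 0]) => {r}.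
  split=> [|a x y /= Fx Fy]; first exact: F0.
  by rewrite FD FZ Fx Fy mul0rz addr0.
move=> r [] [a] [b] [c] -> /=; rewrite FB FD !Fgen ?fDl ?fDr.
all: by rewrite subrr.
Qed.

Let tens_liftE x : tens_lift (\pi_Q x) = F x.
Proof.
apply/eqP; rewrite -subr_eq0 -FB; apply/eqP/F_rels.
set y := repr _.
suff: y == x %[mod Q].
  by rewrite -Quotient.idealrBE => /asboolP.
by rewrite reprK.
Qed.

Lemma tens_lift_tens a v : tens_lift (tens a v) = f a v.
Proof. by rewrite tens_liftE Fgen. Qed.

Lemma tens_liftB : {morph tens_lift : x y / x - y}.
Proof.
elim/quotW=> x; elim/quotW=> y.
by rewrite -raddfB !tens_liftE FB.
Qed.

End Lift.

Lemma tens_ind (P : tensor -> Prop) :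
  (forall a v, P (tens a v)) -> (forall x y, P x -> P y -> P (x - y)) ->
  forall t, P t.
Proof.
move=> Pt PB; have P0 : P 0 by rewrite -(subrr (tens 0 0)); apply: PB.
have PN x : P x -> P (- x) by move=> Px; rewrite -sub0r; apply: PB.
have PD x y : P x -> P y -> P (x + y).
  by move=> Px Py; rewrite -[y]opprK; apply: PB => //; apply: PN.
have PZ n x : P x -> P (x *~ n).
  move=> Px; elim/int_ind: n => [|n IH|n IH]; first by rewrite mulr0z.
    by rewrite intS mulrzDr mulr1z; apply: PD.
  by rewrite intS opprD mulrzDr mulrN1z; apply: PD => //; apply: PN.
elim/quotW=> x; rewrite -(freeg_sumE x) raddf_sum.
apply: (big_ind P) => // -[a v] _; set n := coeff _ _.
have -> : Freeg [:: (n, (a, v))] = tens_gen a v *~ n :> tens_free.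
  by rewrite /tens_gen freeg_mulz intz.
by rewrite raddfMz; apply: PZ; apply: Pt.
Qed.

End Tensor.

Lemma eq_tens (A : nzRingType) (V W : zmodType) (f h : tensor A V -> W) :
  {morph f : x y / x - y} -> {morph h : x y / x - y} ->
  (forall a v, f (tens a v) = h (tens a v)) -> f =1 h.
Proof. by move=> fB hB fh; elim/tens_ind=> // x y; rewrite fB hB => -> ->. Qed.

Section TensorLmod.
Variables (A : nzRingType) (V : zmodType).
Implicit Types (c : A) (t : tensor A V).

Definition tens_scale c t := tens_lift (fun a v => tens (c * a) v) t.

Lemma tens_scale_tens c a (v : V) : tens_scale c (tens a v) = tens (c * a) v.
Proof.
by apply: tens_lift_tens => *; rewrite ?mulrDr ?tensDl ?tensDr.
Qed.

Let scaleB c : {morph tens_scale c : x y / x - y}.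
Proof.
by apply: tens_liftB => *; rewrite ?mulrDr ?tensDl ?tensDr.
Qed.

Lemma tens_scaleDr : right_distributive tens_scale +%R.
Proof.
move=> c; have f0 : tens_scale c 0 = 0 by have := scaleB c 0 0; rewrite !subrr.
have fN y : tens_scale c (- y) = - tens_scale c y.
  by rewrite -[- y]sub0r scaleB f0 sub0r.
by move=> x y; rewrite -{1}(opprK y) scaleB fN opprK.
Qed.

Lemma tens_scaleA c d t : tens_scale c (tens_scale d t) = tens_scale (c * d) t.
Proof.
apply: (eq_tens (f := tens_scale c \o tens_scale d)) t => [x y|x y|a v] /=;
  by rewrite ?scaleB ?tens_scale_tens ?mulrA.
Qed.

Lemma tens_scale1 : left_id 1 tens_scale.
Proof.
by apply: (eq_tens (h := id)) => [x y|x y|a v] //;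
  rewrite ?scaleB ?tens_scale_tens ?mul1r.
Qed.

Lemma tens_scaleDl t : {morph tens_scale^~ t : c d / c + d}.
Proof.
move=> c d; move: t.
apply: (eq_tens (h := fun t => tens_scale c t + tens_scale d t))
  => [x y|x y|a v].
- exact: scaleB.
- by rewrite !scaleB opprD addrACA.
- by rewrite !tens_scale_tens mulrDl tensDl.
Qed.

HB.instance Definition _ := GRing.Zmodule_isLmodule.Build A (tensor A V)
  tens_scaleA tens_scale1 tens_scaleDr tens_scaleDl.

Lemma tensZ c a (v : V) : c *: tens a v = tens (c * a) v.
Proof. exact: tens_scale_tens. Qed.

Section Map.
Variable f : {additive V -> V}.

(* The endomorphism id (x) f *)
Definition tens_map t := tens_lift (fun a v => tens a (f v)) t.

Lemma tens_map_tens a v : tens_map (tens a v) = tens a (f v).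
Proof. by apply: tens_lift_tens => *; rewrite ?raddfD ?tensDl ?tensDr. Qed.

Let mapB : {morph tens_map : x y / x - y}.
Proof. by apply: tens_liftB => *; rewrite ?raddfD ?tensDl ?tensDr. Qed.

Let mapZ : scalable tens_map.
Proof.
move=> c t; apply: (eq_tens (f := fun t => tens_map (c *: t))
  (h := fun t => c *: tens_map t)) => [x y|x y|a v].
- by rewrite scalerBr mapB.
- by rewrite mapB scalerBr.
- by rewrite tensZ !tens_map_tens tensZ.
Qed.

HB.instance Definition _ :=
  GRing.isZmodMorphism.Build (tensor A V) (tensor A V) tens_map mapB.
HB.instance Definition _ :=
  GRing.isScalable.Build A (tensor A V) (tensor A V) *:%R tens_map mapZ.

End Map.
End TensorLmod.

Section PolyAction.
Variables (A : comNzRingType) (V : lmodType A) (l : nat).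
Variable phi : 'I_l -> {linear V -> V}.

Definition monomial_act (m : multinom l) (v : V) : V :=
  foldr (fun i => iter (m i) (phi i)) v (enum 'I_l).

Definition poly_act (p : mpoly l A) (v : V) : V :=
  \sum_(m <- msupp p) mcoeff m p *: monomial_act m v.

(* V as a module over A[X_1, ..., X_l], with X_i acting as phi i. *)
Definition polymod
  & (forall i j v, phi i (phi j v) = phi j (phi i v)) : Type := V.

Hypothesis phiC : forall i j v, phi i (phi j v) = phi j (phi i v).

HB.instance Definition _ := GRing.Zmodule.on (polymod phiC).

Lemma monomial_act_is_linear m : linear (monomial_act m).
Proof.
rewrite /monomial_act; elim: (enum 'I_l) => //= i s IH a u v.
by rewrite IH; elim: (m i) => //= k ->; rewrite linearP.
Qed.

HB.instance Definition _ m :=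
  GRing.isLinear.Build A V V *:%R (monomial_act m) (monomial_act_is_linear m).

Lemma monomial_actM m1 m2 v :
  monomial_act (mnm_add m1 m2) v = monomial_act m1 (monomial_act m2 v).
Proof.
have itC i j a b w : iter a (phi i) (iter b (phi j) w)
                   = iter b (phi j) (iter a (phi i) w).
  have C1 w' : phi i (iter b (phi j) w') = iter b (phi j) (phi i w').
    by elim: b => //= b IHb; rewrite phiC IHb.
  by elim: a => //= a ->; rewrite C1.
rewrite /monomial_act; elim: (enum 'I_l) => //= i s ->.
rewrite mnmDE iterD; congr iter.
move: (foldr _ v s) => w; elim: s => //= j s IH; by rewrite itC IH.
Qed.

Lemma monomial_act0 v : monomial_act mnm0 v = v.
Proof.
by rewrite /monomial_act; elim: (enum 'I_l) => //= i s ->; rewrite mnm0E.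
Qed.

Lemma poly_actE d (p : mpoly l A) v : (msize p <= d)%N ->
  poly_act p v = \sum_(m : bmultinom l d) mcoeff m p *: monomial_act m v.
Proof.
move=> le_pd; rewrite /poly_act (big_mksub (bmultinom l d)) ?msupp_uniq //=.
  rewrite big_rmcond //= => m /memN_msupp_eq0 ->.
  by rewrite scale0r.
by move=> m /msize_mdeg_lt /leq_trans; apply.
Qed.

Lemma poly_actDl v : {morph poly_act^~ v : p q / p + q}.
Proof.
move=> p q; pose d := maxn (msize (p + q)) (maxn (msize p) (msize q)).
rewrite !(@poly_actE d) ?leq_max ?leqnn ?orbT //.
by rewrite -big_split /=; apply: eq_bigr => m _; rewrite mcoeffD scalerDl.
Qed.

Let poly_act0 v : poly_act 0 v = 0.
Proof. by rewrite /poly_act msupp0 big_nil. Qed.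

Lemma poly_actDr p : {morph poly_act p : u v / u + v}.
Proof.
move=> u v; rewrite /poly_act -big_split /=; apply: eq_bigr => m _.
by rewrite raddfD scalerDr.
Qed.

Lemma poly_actZX c m v : poly_act (c *: mpolyX A m) v = c *: monomial_act m v.
Proof.
have [->|c0] := eqVneq c 0; first by rewrite !scale0r /poly_act msupp0 big_nil.
have msE : perm_eq (msupp (c *: mpolyX A m)) [:: m].
  apply: uniq_perm => // x; rewrite mcoeff_msupp mcoeffZ mcoeffX mem_seq1 [x == m]eq_sym.
  by case: (m == x); rewrite ?mulr1 ?mulr0 ?eqxx // c0.
rewrite /poly_act (perm_big _ msE) /= big_seq1.
by rewrite mcoeffZ mcoeffX eqxx mulr1.
Qed.

Lemma poly_actA p q v : poly_act p (poly_act q v) = poly_act (p * q) v.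
Proof.
rewrite mpolyME (big_morph (poly_act^~ v) (poly_actDl v) (poly_act0 v)).
rewrite big_allpairs /= [LHS]/poly_act; apply: eq_bigr => m _.
rewrite [poly_act q v]/poly_act linear_sum scaler_sumr; apply: eq_bigr => m' _.
by rewrite poly_actZX linearZ /= scalerA monomial_actM.
Qed.

Lemma poly_act1 : left_id 1 poly_act.
Proof.
by move=> v; rewrite -[1]scale1r -mpolyX0 poly_actZX scale1r monomial_act0.
Qed.

HB.instance Definition _ := GRing.Zmodule_isLmodule.Build (mpoly l A)
  (polymod phiC) poly_actA poly_act1 poly_actDr poly_actDl.

Lemma polymod_scaleX i (v : polymod phiC) :
  mpolyX A (mnm1 i) *: v = phi i v.
Proof.
rewrite -[mpolyX _ _]scale1r [LHS]poly_actZX scale1r /monomial_act.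
have -> : phi i v = if i \in enum 'I_l then phi i v else v.
  by rewrite mem_enum.
elim: (enum 'I_l) (enum_uniq 'I_l) => //= j s IH /andP[j_s /IH ->].
rewrite mnm1E in_cons; have [->|_] //= := eqVneq i j.
by rewrite (negbTE j_s).
Qed.

Lemma polymod_scaleC c (v : polymod phiC) :
  mpolyC l c *: v = c *: (v : V) :> V.
Proof.
by rewrite -alg_mpolyC -mpolyX0 [LHS]poly_actZX monomial_act0.
Qed.

End PolyAction.

(* Q (x) M as a module over Q[X_1, ..., X_l] = Q (x) Z[X_1, ..., X_l]. *)
Section RatMod.
Variables (l : nat) (M : lmodType (mpoly l int)).

Definition var_act (i : 'I_l) : M -> M := *:%R (mpolyX int (mnm1 i)).

HB.instance Definition _ i :=
  GRing.isZmodMorphism.Build M M (var_act i) (scalerBr _).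

Definition rat_var_act (i : 'I_l) : {linear tensor rat M -> tensor rat M} :=
  tens_map (var_act i).

Lemma rat_var_actC i j t :
  rat_var_act i (rat_var_act j t) = rat_var_act j (rat_var_act i t).
Proof.
apply: (eq_tens (f := rat_var_act i \o rat_var_act j)
  (h := rat_var_act j \o rat_var_act i)) => [x y|x y|a v] /=.
- by rewrite !raddfB.
- by rewrite !raddfB.
rewrite !tens_map_tens /=; congr tens.
by rewrite /var_act !scalerA mulrC.
Qed.

Definition rat_mod : lmodType (mpoly l rat) := polymod rat_var_actC.

End RatMod.

Section Groups.
Variable G : groupType.

Definition is_subgroup (H : set G) :=
  H 1%g /\ forall x y, H x -> H y -> H (x / y)%g.

Definition gen_subgroup (S : set G) : set G := smallest is_subgroup S.

Definition fg_group := exists s : seq G, gen_subgroup [set` s] = setT.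

Definition abelian_group := forall x y : G, commute x y.

Record normal_subgroup := NormalSubgroup {
  nsub_set :> set G;
  nsub_subgroup : is_subgroup nsub_set;
  nsub_normal : forall x y, nsub_set x -> nsub_set (x ^ y)%g
}.

Definition has_index (H : set G) (n : nat) :=
  [set C : set G | exists x, C = [set (x * h)%g | h in H]] #= `I_n.

Definition is_maximal_subgroup (M : set G) :=
  [/\ is_subgroup M, M != setT &
      forall H, is_subgroup H -> M `<=` H -> H = M \/ H = setT].

Definition maximal_subgroups (n : nat) : set (set G) :=
  [set M | is_maximal_subgroup M /\ has_index M n].

(* m_n(G). fset_set sends an infinite set to the empty one; for G finitely
   generated there are only finitely many subgroups of each finite index. *)
Definition num_maximal_subgroups (n : nat) : nat :=
  #|` fset_set (maximal_subgroups n)|%fset.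

(* The infimum is taken in [-oo, +oo]; it is -oo when G has only finitely many
   maximal subgroups of finite index. *)
Definition grp_mdeg (R : realType) : \bar R :=
  ereal_inf [set a%:E | a in [set a : R |
    \forall n \near \oo, (num_maximal_subgroups n)%:R <= n%:R `^ a]].

End Groups.

Section Subgroup.
Variables (G : groupType) (N : normal_subgroup G).

Definition nsub_pred : pred G := fun x => `[< nsub_set N x >].

Definition nsub : Type := {x : G | nsub_pred x}.
HB.instance Definition _ := [isSub of nsub for @sval G nsub_pred].
HB.instance Definition _ := [Choice of nsub by <:].

Lemma nsub_group_closed : group_closed nsub_pred.
Proof.
have [N1 NV] := nsub_subgroup N.
by split=> [|x y /asboolP Nx /asboolP Ny]; apply/asboolP => //; apply: NV.
Qed.

HB.instance Definition _ :=
  SubChoice_isSubGroup.Build G nsub_pred nsub nsub_group_closed.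

Definition coset_equiv : rel G := fun x y => nsub_pred (x^-1 * y)%g.

Let nsubM := group_closedM nsub_group_closed.
Let nsubV := group_closedV nsub_group_closed.
Let nsubJ x y : nsub_pred x -> nsub_pred (x ^ y)%g.
Proof. by move=> /asboolP Nx; apply/asboolP/nsub_normal. Qed.

Lemma coset_equiv_is_equiv : equiv_class_of coset_equiv.
Proof.
have eqV x y : coset_equiv x y -> coset_equiv y x.
  by move=> /nsubV; rewrite /coset_equiv invgM invgK.
split=> [x|x y|y x z]; rewrite /coset_equiv.
- by rewrite mulVg; case: nsub_group_closed.
- by apply/idP/idP; apply: eqV.
- by move=> xy yz; have := nsubM xy yz; rewrite mulgA mulgK.
Qed.

Canonical coset_equiv_equiv := EquivRelPack coset_equiv_is_equiv.
Canonical coset_equiv_encModRel := defaultEncModRel coset_equiv.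

(* The quotient group G / N *)
Definition quotg : Type := {eq_quot coset_equiv}.
HB.instance Definition _ : EqQuotient G coset_equiv quotg :=
  EqQuotient.on quotg.
HB.instance Definition _ := Choice.on quotg.

Definition quotg_one : quotg := \pi_quotg 1%g.
Definition quotg_mul (x y : quotg) : quotg := \pi_quotg (repr x * repr y)%g.
Definition quotg_inv (x : quotg) : quotg := \pi_quotg (repr x)^-1%g.

Lemma pi_quotgM x y : \pi_quotg (x * y)%g = quotg_mul (\pi x) (\pi y).
Proof.
apply/eqmodP; rewrite /= /coset_equiv.
have /eqmodP /= Nx : x = repr (\pi_quotg x) %[mod quotg] by rewrite reprK.
have /eqmodP /= Ny : y = repr (\pi_quotg y) %[mod quotg] by rewrite reprK.
have := nsubM (nsubJ y Nx) Ny.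
by rewrite conjgE !mulgA mulgK invgM ?mulgA.
Qed.

Lemma pi_quotgV x : \pi_quotg x^-1%g = quotg_inv (\pi x).
Proof.
apply/eqmodP; rewrite /= /coset_equiv invgK.
have /eqmodP /= Nx : x = repr (\pi_quotg x) %[mod quotg] by rewrite reprK.
have := nsubJ x^-1%g (nsubV Nx).
by rewrite conjgE invgM !invgK !mulgA mulgK.
Qed.

Let mulA : associative quotg_mul.
Proof.
by elim/quotW=> x; elim/quotW=> y; elim/quotW=> z; rewrite -(pi_quotgM y z) -(pi_quotgM x y) -!pi_quotgM mulgA.
Qed.
Let mul1 : left_id quotg_one quotg_mul.
Proof. by elim/quotW=> x; rewrite -pi_quotgM mul1g. Qed.
Let mulr1 : right_id quotg_one quotg_mul.
Proof. by elim/quotW=> x; rewrite -pi_quotgM mulg1. Qed.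
Let mulV : left_inverse quotg_one quotg_inv quotg_mul.
Proof. by elim/quotW=> x; rewrite -pi_quotgV -pi_quotgM mulVg. Qed.
Let mulrV : right_inverse quotg_one quotg_inv quotg_mul.
Proof. by elim/quotW=> x; rewrite -pi_quotgV -pi_quotgM mulgV. Qed.

HB.instance Definition _ :=
  isGroup.Build quotg mulA mul1 mulr1 mulV mulrV.

End Subgroup.

Section AdditiveGroup.
Variables (A : groupType).

(* An abelian group, in additive notation. *)
Definition addg & abelian_group A : Type := A.

Variable abA : abelian_group A.
HB.instance Definition _ := Choice.on (addg abA).
HB.instance Definition _ := GRing.isZmodule.Build (addg abA)
  (@mulgA A) abA (@mul1g A) (@mulVg A).

End AdditiveGroup.

Section ConjugationModule.
Variables (G : groupType) (N : normal_subgroup G).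
Hypothesis (abN : abelian_group (nsub N)) (abQ : abelian_group (quotg N)).

Lemma nsub_pred_conj (n : nsub N) (x : G) : nsub_pred N (x * val n * x^-1)%g.
Proof.
have /asboolP Nn := valP n; apply/asboolP.
by have := nsub_normal x^-1%g Nn; rewrite conjgE invgK mulgA.
Qed.

Definition conj_nsub (x : G) (n : nsub N) : nsub N := Sub _ (nsub_pred_conj n x).

(* The representative chosen for q is irrelevant, by conj_act_pi. *)
Definition conj_act (q : quotg N) (n : zmodule (addg abN)) :
  zmodule (addg abN) := conj_nsub (repr q) n.

Lemma conj_act_pi x (n : nsub N) : conj_act (\pi_(quotg N) x) n = conj_nsub x n.
Proof.
have /eqmodP /= Nx : x = repr (\pi_(quotg N) x) %[mod quotg N] by rewrite reprK.
apply: val_inj => /=.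
pose m : nsub N := exist (nsub_pred N) _ Nx.
have /= H := congr1 (fun u : nsub N => val u) (abN m n).
have {}H : (x^-1 * repr (\pi_(quotg N) x) * val n =
  val n * (x^-1 * repr (\pi_(quotg N) x)))%g by exact: H.
apply: (mulIg (repr (\pi_(quotg N) x))); apply: (mulgI x^-1%g).
by rewrite !mulgA mulgVK mulVg mul1g H mulgA.
Qed.

Lemma conj_actM q r n : conj_act (q * r)%g n = conj_act q (conj_act r n).
Proof.
elim/quotW: q => x; elim/quotW: r => y.
rewrite [X in conj_act X _](_ : _ = \pi_(quotg N) (x * y)%g); last first.
  by rewrite pi_quotgM.
by rewrite !conj_act_pi; apply: val_inj; rewrite /= invgM !mulgA.
Qed.

Lemma conj_actB q : {morph conj_act q : m n / m - n}.
Proof.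
move=> m n; apply: val_inj.
suff : (repr q * (val (m : nsub N) * (val (n : nsub N))^-1) * (repr q)^-1 =
  (repr q * val (m : nsub N) * (repr q)^-1) *
  (repr q * val (n : nsub N) * (repr q)^-1)^-1)%g by [].
by rewrite !invgM invgK !mulgA mulgVK.
Qed.

HB.instance Definition _ q := GRing.isZmodMorphism.Build
  (zmodule (addg abN)) (zmodule (addg abN)) (conj_act q) (@conj_actB q).

Lemma conj_actZ q : scalable (conj_act q).
Proof. by move=> a n; rewrite !scalezrE raddfMz. Qed.

HB.instance Definition _ q := GRing.isScalable.Build int
  (zmodule (addg abN)) (zmodule (addg abN)) *:%R (conj_act q) (@conj_actZ q).

Lemma conj_actC q r n : conj_act q (conj_act r n) = conj_act r (conj_act q n).
Proof. by rewrite -!conj_actM abQ. Qed.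

Variables (l0 : nat) (g : 'I_l0 -> quotg N).

(* N as a module over Z[X_1, ..., X_l0], X_i acting as conjugation by g i. *)
Definition conj_mod : lmodType (mpoly l0 int) :=
  polymod (A := int) (V := zmodule (addg abN)) (phi := fun i => conj_act (g i))
    (fun i j n => conj_actC (g i) (g j) n).

End ConjugationModule.

(* The extension N -> G -> G / N splits, i.e. G is the semidirect product of N
   and a subgroup mapped isomorphically onto G / N. *)
Definition splits (G : groupType) (N : normal_subgroup G) :=
  exists2 s : quotg N -> G,
    {morph s : x y / (x * y)%g} & forall q, \pi_(quotg N) (s q) = q.

(* The ideal (X_1 - 1, ..., X_l - 1) of Z[X_1, ..., X_l]. *)
Definition aug_ideal (l : nat) : set (mpoly l int) :=
  submod_span (M := (mpoly l int)^o) (range (fun i => mpolyX int (mnm1 i) - 1)).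
Arguments aug_ideal l : clear implicits.

(* Main.v *)
Require Import Defs.
From mathcomp Require Import all_boot all_order all_algebra.
From mathcomp Require Import classical_sets reals ereal.
From mathcomp Require Import finmap boolp functions cardinality zify.
From mathcomp Require Import topology normedtype sequences exp.
From mathcomp Require Import -(notations) mpoly.

Set Implicit Arguments.
Unset Strict Implicit.
Unset Printing Implicit Defensive.

Import Order.TTheory GRing.Theory Num.Theory.
Local Open Scope classical_set_scope.
Local Open Scope ring_scope.
Local Open Scope quotient_scope.
Local Open Scope card_scope.

(** A maximal subgroup [M] of finite index [n] either contains the derived
    subgroup of [G] or does not, and the two kinds account for the two terms of
    the maximum.

    If [M] contains the derived subgroup, it is the preimage of a maximal
    subgroup of the abelianization [G^ab], a finitely generated abelian group.
    Up to finite index [G^ab] is generated by lifts of independent elements of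
    [G/N] and of [N/IN], that is by [l + t] elements, and exactly so when the
    extension splits: then [G^ab] is the product of [G/N] and [N/IN].

    If not, then [M] does not contain [N], since [G/N] is abelian.  So [MN = G]
    and [K = M :&: N] is a maximal submodule of [N] with [N/K] of order [n], and
    some [X_i - 1] acts on [N/K] as a nonzero, hence invertible, map.  Fix [h]
    over the generator [g_i].  The subgroup [M] meets the coset [hN] in a single
    coset [huK], and [M] is the centralizer of [hu] modulo [K]: if [hu] commutes
    with [w] in [N] modulo [K], then [w] is in [K].  Conversely each such
    centralizer is a maximal subgroup of index [n] because [X_i - 1] is
    invertible on [N/K].  Hence each [K] gives exactly
    [n] subgroups [M] ([supplement_centr], [centr_max], [centr_inj]).

    Both kinds thus reduce to one question on a module [E] over a commutative
    ring [R], with [E] finitely generated as an abelian group: how many maximal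
    submodules [K] have [#|E/K| = n]?  The ring is the integers for [G^ab] and
    the polynomial ring for [N].  Such a [K] has as annihilator of [E/K] a
    maximal ideal [m] with [#|R/m| = n], and [E/K] is a line over the field
    [R/m].

    - Upper bound ([max_submod_code]).  If [DE] lies in the span of [k] elements
      and [D] is not in [m], these elements generate [E/mE], which has at most
      [k n^(k-1)] hyperplanes.  By the Chinese remainder theorem the number of
      ideals [m] is bounded by the number of generators of the group [E].  As
      [E/DE] is finite, [D] is in [m] only for bounded [n].
    - Lower bound ([many_max_submods_prime]).  Suppose that [k+1] generators are
      needed for [E/pE], with [p] prime.  By the Chinese remainder theorem and
      Nakayama's argument they are needed for some [E/mE] with [m] above [p].
      This vector space has at least [n^k] hyperplanes, and [n >= p].

    The determinant trick ([isolator_mod]) connects the primes [p] with the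
    rational numbers: if some elements generate [E/pE] over [R], they generate a
    submodule of finite index.  So [N/pN] needs [d] generators for every [p], and
    [G^ab/p] needs [l + t] in the split case.

    For the lower bound [d] the ideal [m] found in this way must not contain all
    the [X_i - 1].  If it does and [p] is large, then [N/mN] is a quotient of
    [N/(IN + pN)], which [t] elements generate, so [d <= t]; and then
    [d <= l + t - 1], because [l >= 1]. *)

(** * Maximal submodules and their annihilators *)

Section Submodules.
Variables (R : comNzRingType) (E : lmodType R).
Implicit Types (K L W : set E) (x y : E) (a b c : R).

Section Closure.
Variables (W : set E) (sW : is_submod W).

Lemma submod0 : W 0. Proof. by case: sW. Qed.

Lemma submodZ a x : W x -> W (a *: x).
Proof. by case: sW => W0 WZ Wx; rewrite -[_ *: _]addr0; apply: WZ. Qed.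

Lemma submodD x y : W x -> W y -> W (x + y).
Proof. by case: sW => _ WZ Wx Wy; rewrite -[x]scale1r; apply: WZ. Qed.

Lemma submodN x : W x -> W (- x).
Proof. by move=> Wx; rewrite -scaleN1r; apply: submodZ. Qed.

Lemma submodB x y : W x -> W y -> W (x - y).
Proof. by move=> Wx Wy; apply: submodD => //; apply: submodN. Qed.

Lemma submodMz x (n : int) : W x -> W (x *~ n).
Proof. by move=> Wx; rewrite -scaler_int; apply: submodZ. Qed.

Lemma submod_sum (I : Type) (r : seq I) (P : pred I) (F : I -> E) :
  (forall i, P i -> W (F i)) -> W (\sum_(i <- r | P i) F i).
Proof. by move=> WF; apply: big_ind => //; [apply: submod0 | apply: submodD]. Qed.

Lemma submodBl x y : W (x - y) -> W x -> W y.
Proof. by move=> Wxy Wx; rewrite -[y](subKr x); apply: submodB. Qed.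

Lemma submodBr x y : W (x - y) -> W y -> W x.
Proof. by move=> Wxy Wy; rewrite -[x](subrK y); apply: submodD. Qed.

Lemma submodBC x y : W (x - y) -> W (y - x).
Proof. by rewrite -(opprB x y); apply: submodN. Qed.

Lemma submodB_trans x y z : W (x - y) -> W (y - z) -> W (x - z).
Proof. by move=> Wxy Wyz; rewrite -(subrKA y); apply: submodD. Qed.

End Closure.

Definition lincomb k (v : 'I_k -> E) : set E :=
  [set x | exists a : 'I_k -> R, x = \sum_i a i *: v i].

Lemma lincomb_submod k (v : 'I_k -> E) : is_submod (lincomb v).
Proof.
split=> [|a _ _ [b ->] [c ->]].
  by exists (fun=> 0); rewrite big1 // => i _; rewrite scale0r.
exists (fun i => a * b i + c i); rewrite scaler_sumr -big_split /=.
by apply: eq_bigr => i _; rewrite scalerDl scalerA.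
Qed.

Lemma lincomb_gen k (v : 'I_k -> E) i : lincomb v (v i).
Proof.
exists (fun j => (j == i)%:R); rewrite (bigD1 i) //= eqxx scale1r big1 ?addr0 //.
by move=> j /negbTE->; rewrite scale0r.
Qed.

Lemma lincomb_sub k (v : 'I_k -> E) W :
  is_submod W -> (forall i, W (v i)) -> lincomb v `<=` W.
Proof.
move=> sW Wv _ [a ->]; apply: submod_sum => // i _; exact: submodZ.
Qed.

Definition add_submod W L : set E := [set x | exists w l, [/\ W w, L l & x = w + l]].

Lemma add_submodP W L : is_submod W -> is_submod L -> is_submod (add_submod W L).
Proof.
move=> sW sL; split; first by exists 0, 0; rewrite addr0; split=> //; apply: submod0.
move=> a _ _ [w [l [Ww Ll ->]]] [w' [l' [Ww' Ll' ->]]].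
exists (a *: w + w'), (a *: l + l'); split.
- by case: sW => _; apply.
- by case: sL => _; apply.
by rewrite scalerDr addrACA.
Qed.

Lemma add_submodl W L : is_submod L -> W `<=` add_submod W L.
Proof. by move=> sL w Ww; exists w, 0; rewrite addr0; split=> //; apply: submod0. Qed.

Lemma add_submodr W L : is_submod W -> L `<=` add_submod W L.
Proof. by move=> sW l Ll; exists 0, l; rewrite add0r; split=> //; apply: submod0. Qed.

Definition cyc x : set E := [set a *: x | a in setT].

Lemma cyc_submod x : is_submod (cyc x).
Proof.
split; first by exists 0; rewrite ?scale0r.
by move=> a _ _ [b _ <-] [c _ <-]; exists (a * b + c); rewrite // scalerDl scalerA.
Qed.

Lemma cyc_id x : cyc x x. Proof. by exists 1; rewrite ?scale1r. Qed.

Lemma submod_preim_scale W a : is_submod W -> is_submod [set x | W (a *: x)].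
Proof.
move=> sW; split=> [|b x y Wx Wy] /=; first by rewrite scaler0; apply: submod0.
rewrite scalerDr scalerA mulrC -scalerA.
by apply: submodD => //; apply: submodZ.
Qed.

(** An application of Zorn's lemma. The avoided vector serves to construct
    complements of the line that it spans, and maximal submodules. *)
Lemma submod_avoid L x : is_submod L -> ~ L x ->
  exists K, [/\ is_submod K, L `<=` K, ~ K x &
    forall K', is_submod K' -> K `<=` K' -> ~ K' x -> K' = K].
Proof.
move=> sL Lx.
pose P : set (set E) := [set A | is_submod (L `|` A) /\ ~ (L `|` A) x].
case: (@Zorn_bigcup E P) => [F FP Ftot|A [[sA Ax] Amax]].
  split; last by move=> [//|[A /FP[_ +] Ax]]; apply; right.
  split; first by left; apply: submod0.
  have FA A : F A -> is_submod (L `|` A) by move=> /FP[].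
  move=> a u v [Lu|[A A_F Au]] [Lv|[B B_F Bv]].
  - by left; case: sL => _; apply.
  - have [||?|?] := (FA B B_F).2 a u v; [by left|by right|by left|by right; exists B].
  - have [||?|?] := (FA A A_F).2 a u v; [by right|by left|by left|by right; exists A].
  - have [AB|BA] := Ftot A B A_F B_F.
      have [||?|?] := (FA B B_F).2 a u v.
      + by right; apply: AB.
      + by right.
      + by left.
      by right; exists B.
    have [||?|?] := (FA A A_F).2 a u v.
    + by right.
    + by right; apply: BA.
    + by left.
    by right; exists A.
exists (L `|` A); split=> // K' sK' KK' K'x.
apply: contrapT => nKK'; apply: (Amax K').
  split; first by move=> z Az; apply: KK'; right.
  by move=> K'A; apply: nKK'; apply/seteqP; split=> // z /K'A; right.
have LK : L `|` K' = K'; last by split; rewrite LK.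
by apply/seteqP; split=> z; [case=> // Lz; apply: KK'; left | right].
Qed.

Definition max_submod K :=
  [/\ is_submod K, K != setT &
      forall L, is_submod L -> K `<=` L -> L = K \/ L = setT].

Definition ann K : set R := [set a | forall x, K (a *: x)].

Lemma max_submod_out K : max_submod K -> exists x, ~ K x.
Proof.
move=> [_ /eqP KT _]; apply/existsNP => KA; apply: KT.
by apply/seteqP; split.
Qed.

Lemma max_submod_gen K L x : max_submod K -> is_submod L -> K `<=` L ->
  L x -> ~ K x -> forall y, L y.
Proof.
move=> [_ _ Kmax] sL KL Lx Kx y; have [LK|->//] := Kmax L sL KL.
by rewrite LK in Lx.
Qed.

(** Schur's lemma: [a] acts on the simple module [E / K] by zero or injectively. *)
Lemma ann_reg K a x : max_submod K -> ~ ann K a -> K (a *: x) -> K x.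
Proof.
move=> maxK Ka Kax; have [sK _ _] := maxK; apply: contrapT => Kx; apply: Ka.
apply: (max_submod_gen maxK (submod_preim_scale a sK)) Kax Kx => y Ky /=.
exact: submodZ.
Qed.

Lemma annB K a b : is_submod K -> ann K a -> ann K b -> ann K (a - b).
Proof. by move=> sK Ka Kb x; rewrite scalerBl; apply: submodB. Qed.

Lemma annD K a b : is_submod K -> ann K a -> ann K b -> ann K (a + b).
Proof. by move=> sK Ka Kb x; rewrite scalerDl; apply: submodD. Qed.

Lemma annMr K a b : ann K a -> ann K (a * b).
Proof. by move=> Ka x; rewrite -scalerA. Qed.

Lemma annMl K a b : ann K b -> ann K (a * b).
Proof. by rewrite mulrC; apply: annMr. Qed.

Lemma ann0 K : is_submod K -> ann K 0.
Proof. by move=> sK x; rewrite scale0r; apply: submod0. Qed.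

Lemma ann1 K : max_submod K -> ~ ann K 1.
Proof.
by move=> /max_submod_out[x Kx] K1; apply: Kx; rewrite -[x]scale1r.
Qed.

Lemma ann_prime K a b : max_submod K -> ~ ann K a -> ~ ann K b -> ~ ann K (a * b).
Proof.
move=> maxK Ka Kb Kab; apply: Kb => x.
by apply: (ann_reg maxK Ka); rewrite scalerA.
Qed.

Lemma annE K a x : max_submod K -> ~ K x -> ann K a <-> K (a *: x).
Proof.
move=> maxK Kx; split=> [|Kax]; first exact.
by apply: contrapT => Ka; apply: Kx; apply: ann_reg Kax.
Qed.

Lemma max_submod_cyc K x : max_submod K -> ~ K x ->
  forall y, exists a, K (y - a *: x).
Proof.
move=> maxK Kx y; have [sK _ _] := maxK.
have sC := cyc_submod x.
have [k [_ [Kk [a _ <-] ->]]] := max_submod_gen maxK (add_submodP sK sC)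
  (add_submodl sC) (add_submodr sK (cyc_id x)) Kx y.
by exists a; rewrite addrK.
Qed.

Lemma ann_inv K a : max_submod K -> ~ ann K a -> exists c, ann K (c * a - 1).
Proof.
move=> maxK Ka; have [x Kx] := max_submod_out maxK; have [sK _ _] := maxK.
have Kax : ~ K (a *: x) by move/(ann_reg maxK Ka).
have [c Kc] := max_submod_cyc maxK Kax x; exists c; apply/(annE _ maxK Kx).
by rewrite scalerBl scale1r -scalerA; apply: submodBC.
Qed.

(** The annihilator of a simple module over a commutative ring is a maximal
    ideal, hence is not properly contained in another one. *)
Lemma ann_sub_eq K K' : max_submod K -> max_submod K' ->
  ann K `<=` ann K' -> ann K = ann K'.
Proof.
move=> maxK maxK' KK'; apply/seteqP; split=> // a K'a; apply: contrapT => Ka.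
have [c /KK' K'c] := ann_inv maxK Ka; apply: (ann1 maxK').
rewrite -[1](subKr (c * a)); have [sK' _ _] := maxK'.
by apply: annB => //; apply: annMl.
Qed.

(** The Chinese remainder theorem, for the maximal ideals [ann (K i)]. *)
Lemma ann_crt j (K : 'I_j -> set E) : (forall i, max_submod (K i)) ->
  (forall i k, ann (K i) = ann (K k) -> i = k) ->
  exists e : 'I_j -> R, forall i k, ann (K k) (e i - (i == k)%:R).
Proof.
move=> maxK injK; suff H i : exists e, forall k, ann (K k) (e - (i == k)%:R).
  by have [e He] := choice H; exists e.
have sK k : is_submod (K k) by case: (maxK k).
have /choice[b Hb] k : exists b, k != i -> ann (K k) b /\ ~ ann (K i) b.
  have [->|ki] := eqVneq k i; first by exists 0.
  apply: contrapT => /forallNP H; move/eqP: ki; apply.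
  apply: injK; apply: ann_sub_eq => // b Kb; apply: contrapT => Kib.
  by apply: (H b).
have Kib : ~ ann (K i) (\prod_(k | k != i) b k).
  elim/big_ind: _ => [|x y|k /Hb[]//]; first exact: ann1.
  exact: ann_prime.
have [c Kc] := ann_inv (maxK i) Kib.
exists (c * \prod_(k | k != i) b k) => k; have [<-//|ik] := eqVneq i k.
rewrite subr0 (bigD1 k) 1?eq_sym //=; apply: annMl; apply: annMr.
by rewrite eq_sym in ik; case: (Hb _ ik).
Qed.

End Submodules.

(** * Finite quotients *)

Definition Zspans (A : zmodType) k (v : 'I_k -> A) :=
  forall x, exists c : 'I_k -> int, x = \sum_i v i *~ c i.

(** Identifies the quotient of [T] by [r] with ['I_n] without forming it. *)
Definition enumerates (T : Type) (r : T -> T -> Prop) n (e : T -> 'I_n) :=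
  (forall i, exists x, e x = i) /\ forall x y, e x = e y <-> r x y.

Lemma enumerates_fin (T : Type) (F : finType) (f : T -> F) :
  exists n (e : T -> 'I_n), enumerates (fun x y => f x = f y) e.
Proof.
pose A := [set z | `[< exists x, f x = z >]]%SET.
have fA x : f x \in A by rewrite inE; apply/asboolP; exists x.
exists #|A|, (fun x => enum_rank_in (fA x) (f x)); split=> [i|x y].
  have := enum_valP i; rewrite inE => /asboolP[x fx]; exists x.
  by apply: enum_val_inj; rewrite enum_rankK_in.
split=> [|fxy]; first by move/(congr1 enum_val); rewrite !enum_rankK_in.
by apply: enum_val_inj; rewrite !enum_rankK_in.
Qed.

Section Size.
Variables (R : comNzRingType) (E : lmodType R).
Implicit Types (K L W : set E) (x : E) (n q : nat).

Definition quot_enum K n (e : E -> 'I_n) := enumerates (fun x y => K (x - y)) e.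

Definition quot_size K n := exists e : E -> 'I_n, quot_enum K e.

(** Lagrange's theorem: translation by [x] permutes [E / K], so it does not
    change the sum of all elements, but adds [n x] to it. *)
Lemma quot_lagrange K n : is_submod K -> quot_size K n -> ann K n%:R.
Proof.
move=> sK [e [esurj eK]] x; have [r er] := choice esurj.
pose f i := e (r i + x).
have rf i : K (r (f i) - (r i + x)) by apply/eK; rewrite er.
have finj : injective f.
  by move=> i k /eK; rewrite opprD addrACA subrr addr0 => /eK; rewrite !er.
rewrite scaler_nat.
have -> : x *+ n = \sum_i - (r (f i) - (r i + x)).
  rewrite sumrN sumrB big_split /= sumr_const card_ord opprB.
  have -> : \sum_i r (f i) = \sum_i r i by rewrite [RHS](reindex_inj finj).
  by rewrite addrAC subrr add0r.
by apply: submod_sum => // i _; apply: submodN.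
Qed.

Variables (s : nat) (y : 'I_s -> E).
Hypothesis y_spans : Zspans y.

Lemma residue q x : (0 < q)%N -> exists (c : {ffun 'I_s -> 'I_q}) z,
  x = \sum_i y i *+ c i + q%:R *: z.
Proof.
case: q => // q _; have [c ->] := y_spans x.
exists [ffun i => inord `|(c i %% q.+1)%Z|%N].
exists (\sum_i y i *~ (c i %/ q.+1)%Z); rewrite scaler_sumr -big_split /=.
apply: eq_bigr => i _; rewrite ffunE.
have m0 : (0 <= (c i %% q.+1)%Z) by rewrite modz_ge0.
rewrite inordK; last first.
  by rewrite -ltz_nat gez0_abs // ltz_pmod.
rewrite pmulrn gez0_abs // scaler_nat pmulrn -mulrzA -mulrzDr addrC.
by rewrite -[LHS]/(y i *~ c i) {1}(divz_eq (c i) q.+1).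
Qed.

Lemma quot_size_le K n q : is_submod K -> quot_size K n ->
  (0 < q)%N -> ann K q%:R -> (n <= q ^ s)%N.
Proof.
move=> sK [e [esurj eK]] q0 Kq.
have /choice[g Hg] i : exists c : {ffun 'I_s -> 'I_q}, e (\sum_k y k *+ c k) = i.
  have [x <-] := esurj i; have [c [z ->]] := residue x q0; exists c.
  by apply/eK; apply: submodBC => //; rewrite addrAC subrr add0r.
have /leq_card : injective g by move=> i k gik; rewrite -(Hg i) -(Hg k) gik.
by rewrite card_ffun !card_ord.
Qed.

Lemma quot_size_exists K q : is_submod K -> (0 < q)%N -> ann K q%:R ->
  exists n, quot_size K n.
Proof.
move=> sK q0 Kq.
pose f x := [pick c : {ffun 'I_s -> 'I_q} | `[< K (x - \sum_k y k *+ c k) >]].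
have [n [e [esurj ef]]] := enumerates_fin f; exists n, e; split=> // u v.
split=> [/ef|Kuv].
  rewrite /f; case: pickP => [c /asboolP Kc|H].
    case: pickP => // c' /asboolP Kc' [cc']; rewrite -cc' in Kc'.
    by apply: submodB_trans Kc _ => //; apply: submodBC.
  have [c [z uE]] := residue u q0; have /asboolP[] := H c.
  by rewrite uE addrAC subrr add0r.
apply/ef/eq_pick => c /=; apply: asbool_equiv_eq; split=> Kc.
  by apply: submodB_trans Kc => //; apply: submodBC.
exact: submodB_trans Kc.
Qed.

(** The bound comes from [E / qE], of order at most [q ^ s], which by the Chinese
    remainder theorem maps onto the product of the [E / K i]. *)
Lemma ann_count q b j (K : 'I_j -> set E) (r : 'I_j -> 'I_b -> E) :
  (0 < q)%N -> (forall i, max_submod (K i)) -> (forall i, ann (K i) q%:R) ->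
  (forall i k, ann (K i) = ann (K k) -> i = k) ->
  (forall i u v, K i (r i u - r i v) -> u = v) -> (b ^ j <= q ^ s)%N.
Proof.
move=> q0 maxK Kq injK Kr; have [a Ha] := ann_crt maxK injK.
pose x (f : {ffun 'I_j -> 'I_b}) := \sum_i a i *: r i (f i).
have Kx k f : K k (x f - r k (f k)).
  have [sK _ _] := maxK k.
  rewrite /x (bigD1 k) //= addrAC; apply: submodD => //.
    rewrite -[X in _ - X]scale1r -scalerBl.
    by have := Ha k k; rewrite eqxx; apply.
  apply: submod_sum => // i ik; have := Ha i k.
  by rewrite (negbTE ik) subr0; apply.
have /choice[c Hc] f : exists c : {ffun 'I_s -> 'I_q},
    exists z, x f = \sum_i y i *+ c i + q%:R *: z.
  by have [c [z ?]] := residue (x f) q0; exists c, z.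
have /leq_card : injective c.
  move=> f f' cff; apply/ffunP => k; apply: (Kr k); have [sK _ _] := maxK k.
  apply: (submodB_trans sK (submodBC sK (Kx k f))).
  apply: submodB_trans (Kx k f') => //.
  have [z ->] := Hc f; have [z' ->] := Hc f'; rewrite cff.
  rewrite opprD addrACA subrr add0r.
  by rewrite -scalerBr; apply: Kq.
by rewrite !card_ffun !card_ord.
Qed.

(** Bounded families with distinct annihilators can be completed until they
    meet all annihilators of members of [C]. *)
Lemma ann_exhaust (C : set (set E)) B :
  (forall j (K : 'I_j -> set E), (forall i, C (K i)) ->
     (forall i k, ann (K i) = ann (K k) -> i = k) -> (j <= B)%N) ->
  exists j (K : 'I_j -> set E), [/\ (j <= B)%N, forall i, C (K i),
    forall i k, ann (K i) = ann (K k) -> i = k &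
    forall K', C K' -> exists i, ann K' = ann (K i)].
Proof.
move=> CB.
pose P j := `[< exists K : 'I_j -> set E, (forall i, C (K i)) /\
                  (forall i k, ann (K i) = ann (K k) -> i = k) >].
have P0 : exists j, P j.
  by exists 0%N; apply/asboolP; exists (fun=> setT); split; case.
have PB j : P j -> (j <= B)%N by move=> /asboolP[K [KC Ki]]; apply: (CB j K).
case: (ex_maxnP P0 PB) => j /asboolP[K [KC Ki]] jmax.
exists j, K; split=> // [|K' CK']; first exact: CB Ki.
apply: contrapT => /forallNP H; suff /jmax : P j.+1 by rewrite ltnn.
apply/asboolP; exists (fun i => if unlift ord0 i is Some k then K k else K').
split=> [i|i k]; first by case: unliftP.
case: (unliftP ord0 i) => [i'|] ->; case: (unliftP ord0 k) => [k'|] -> //.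
- by move=> /Ki->.
- by move=> /esym/H.
- by move=> /H.
Qed.

End Size.

(** * Maximal submodules of given index: upper bound *)

Section Count.
Variables (R : comNzRingType) (E : lmodType R).
Implicit Types (K L W : set E) (x : E) (n q : nat).

Lemma ann_coprime K a b : max_submod K -> ann K a%:R -> ann K b%:R ->
  ~~ coprime a b.
Proof.
move=> maxK Ka Kb; have [sK _ _] := maxK; apply/negP.
case: (posnP a) => [a0|a0].
  rewrite a0 /coprime gcd0n => /eqP b1; apply: (ann1 maxK).
  by rewrite -[1]/(1%:R) -b1.
move=> /(coprimeP _ a0)[[u v] /= uv]; apply: (ann1 maxK).
rewrite -[1]/(1%:R) -uv natrB; last by rewrite leqNgt -subn_gt0; lia.
rewrite !natrM; apply: annB => //; exact: annMl.
Qed.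

Definition ann_enum K n (e : R -> 'I_n) := enumerates (fun a b => ann K (a - b)) e.

(** [R / ann K] and [E / K] are isomorphic through [a |-> a x], for any [x]
    outside of [K]. *)
Lemma quot_ann_enum K n : max_submod K -> quot_size K n ->
  exists e : R -> 'I_n, ann_enum K e.
Proof.
move=> maxK [e [esurj eK]]; have [x Kx] := max_submod_out maxK.
have [sK _ _] := maxK.
exists (fun a => e (a *: x)); split=> [i|a b].
  have [z <-] := esurj i; have [a Ka] := max_submod_cyc maxK Kx z.
  by exists a; apply/eK; apply: submodBC.
rewrite eK -scalerBl; split=> [|]; last by apply.
by move/(annE _ maxK Kx).
Qed.

Lemma ann_quot_enum K n : max_submod K ->
  (exists e : R -> 'I_n, ann_enum K e) -> quot_size K n.
Proof.
move=> maxK [e [esurj eK]]; have [x Kx] := max_submod_out maxK.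
have [sK _ _] := maxK.
have [c Kc] := choice (max_submod_cyc maxK Kx).
exists (e \o c); split=> [i|y z] /=.
  have [a <-] := esurj i; exists (a *: x); apply/eK/(annE _ maxK Kx).
  by rewrite scalerBl; apply: submodBC.
rewrite eK (annE _ maxK Kx) scalerBl; split=> H.
  apply: submodB_trans (Kc y) _ => //; apply: submodB_trans H _ => //.
  exact: submodBC.
apply: submodB_trans (submodBC sK (Kc y)) _ => //.
by apply: submodB_trans H _.
Qed.

Variables (s : nat) (y : 'I_s -> E).
Hypothesis y_spans : Zspans y.

Lemma ann_size_count n j (K : 'I_j -> set E) : (1 < n)%N ->
  (forall i, max_submod (K i) /\ quot_size (K i) n) ->
  (forall i k, ann (K i) = ann (K k) -> i = k) -> (j <= s)%N.
Proof.
move=> n1 KC Ki; rewrite -(leq_exp2l _ _ n1).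
have /choice[r Hr] i : exists r : 'I_n -> E, forall u v, K i (r u - r v) -> u = v.
  have [_ [e [esurj eK]]] := KC i; have [r er] := choice esurj.
  by exists r => u v /eK; rewrite !er.
apply: (ann_count y_spans (q := n) (r := r)) Hr => // [|i|i].
- exact: ltnW.
- by have [] := KC i.
by have [[sK _ _] /quot_lagrange] := KC i; apply.
Qed.

(** The code of [K] consists of its annihilator (one of at most [s]), of a pivot
    [v i] outside of [K], and of the ratios of the other [v u] to [v i], which lie
    in the field [R / ann K]. Normalizing by the pivot is what makes the exponent
    of [n] equal to [d - 1] and not to [d]. *)
Lemma max_submod_code (D d : nat) (v : 'I_d -> E) n :
  (forall x, lincomb v (D%:R *: x)) -> (1 < n)%N ->
  exists code : set E -> 'I_s * 'I_d * {ffun 'I_d.-1 -> 'I_n} -> Prop,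
    (forall K, max_submod K -> quot_size K n -> ~ ann K D%:R -> exists c, code K c) /\
    (forall K K' c, code K c -> code K' c -> K = K').
Proof.
move=> vD n1.
pose C : set (set E) := [set K | max_submod K /\ quot_size K n].
have [|j [K0 [js K0C _ K0ex]]] := @ann_exhaust _ _ C s.
  by move=> j K; apply: ann_size_count.
have /choice[e He] h : exists e : R -> 'I_n, ann_enum (K0 h) e.
  by have [maxK sizeK] := K0C h; apply: quot_ann_enum.
exists (fun K (z : 'I_s * 'I_d * {ffun 'I_d.-1 -> 'I_n}) =>
  [/\ max_submod K, ~ ann K D%:R, ~ K (v z.1.2) &
  exists h : 'I_j, [/\ z.1.1 = widen_ord js h, ann K = ann (K0 h) &
  forall u, exists c, K (v (lift z.1.2 u) - c *: v z.1.2) /\ e h c = z.2 u]]).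
split=> [K maxK sizeK KD|].
  have [sK _ _] := maxK.
  have [i Ki] : exists i, ~ K (v i).
    apply/existsNP => Kv; apply: KD => x; exact: (lincomb_sub sK Kv).
  have [h Kh] := K0ex K (conj maxK sizeK).
  have [c Hc] := choice (max_submod_cyc maxK Ki).
  exists (widen_ord js h, i, [ffun u => e h (c (v (lift i u)))]); split=> //=.
  exists h; split=> // u; exists (c (v (lift i u))); rewrite ffunE; split=> //.
move=> K K' [[h0 i] f].
(* For [x] in [L], [D x] is a combination of the [v u], congruent modulo [L] to
   a multiple of [v i]; its coefficient lies in the common annihilator. *)
have sub L L' : max_submod L -> max_submod L' -> ~ ann L' D%:R -> ~ L (v i) ->
    ann L = ann L' ->
    (forall u, exists c, L (v u - c.1 *: v i) /\
       (L' (v u - c.2 *: v i) /\ ann L (c.1 - c.2))) -> L `<=` L'.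
  move=> maxL maxL' LD Li LL' /choice[c Hc] x Lx.
  have [sL _ _] := maxL; have [sL' _ _] := maxL'.
  apply: (ann_reg maxL' LD); have [a Da] := vD x.
  have La : ann L (\sum_u a u * (c u).1).
    apply/(annE _ maxL Li); rewrite scaler_suml.
    have: L (D%:R *: x) by apply: submodZ.
    apply: submodBl; first by [].
    rewrite Da -sumrB; apply: submod_sum => // u _.
    by rewrite -scalerA -scalerBr; apply: submodZ => //; case: (Hc u).
  have La' : ann L' (\sum_u a u * (c u).2).
    rewrite -LL'.
    have -> : \sum_u a u * (c u).2 =
        \sum_u a u * (c u).1 - \sum_u a u * ((c u).1 - (c u).2).
      by rewrite -sumrB; apply: eq_bigr => u _; rewrite -mulrBr subKr.
    apply: annB => //; elim/big_ind: _ => [|b b'|u _]; first exact: ann0.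
      exact: annD.
    by apply: annMl; case: (Hc u) => _ [].
  have: L' ((\sum_u a u * (c u).2) *: v i) by [].
  apply: submodBr => //; rewrite Da scaler_suml -sumrB.
  apply: submod_sum => // u _.
  by rewrite -scalerA -scalerBr; apply: submodZ => //; case: (Hc u) => _ [].
move=> [/= maxK KD Ki [h [h0E Kh Kf]]] [/= maxK' KD' Ki' [h' [h0E' Kh' Kf']]].
have {h0E h0E'}hh : h' = h.
  by apply: val_inj; move: h0E'; rewrite h0E => /(congr1 val) /=.
rewrite hh in Kh' Kf' => {h' hh}.
have [_ eK] := He h.
have KK' : ann K = ann K' by rewrite Kh Kh'.
have [sK _ _] := maxK; have [sK' _ _] := maxK'.
have key u : exists c, K (v u - c.1 *: v i) /\
       (K' (v u - c.2 *: v i) /\ ann K (c.1 - c.2)).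
  case: (unliftP i u) => [u' ->|->].
    have [c [Kc ec]] := Kf u'; have [c' [Kc' ec']] := Kf' u'.
    by exists (c, c'); split=> //; split=> //; rewrite Kh; apply/eK; rewrite ec.
  exists (1, 1); rewrite /= scale1r !subrr; split; first exact: submod0.
  by split; [apply: submod0 | apply: ann0].
apply/seteqP; split; first exact: sub.
apply: sub => // u; have [c [Kc [Kc' cc]]] := key u; exists (c.2, c.1); split=> //.
by split=> //=; rewrite -KK' -opprB -[- _]sub0r; apply: annB => //; apply: ann0.
Qed.

End Count.

(** * Maximal submodules of given index: lower bound *)

Section Hyperplanes.
Variables (R : comNzRingType) (E : lmodType R).
Implicit Types (K L W : set E) (x : E) (n q : nat).

Definition ann_mul K : set E := mul_ideal E (ann K).

Lemma ann_mul_submod K : is_submod (ann_mul K).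
Proof. exact: span_submod. Qed.

Lemma ann_mul_gen K a x : ann K a -> ann_mul K (a *: x).
Proof. by move=> Ka; apply: Defs.sub_span; exists a, x. Qed.

Lemma ann_mul_sub K W : is_submod W -> ann K `<=` ann W -> ann_mul K `<=` W.
Proof.
by move=> sW KW; apply: smallest_sub => // _ [a [x [/KW Wa ->]]]; apply: Wa.
Qed.

(** The negative form is the one that a greedy choice of vectors consumes. *)
Definition nongen k W :=
  forall w : 'I_k -> E, exists x, ~ add_submod (lincomb w) W x.

(** Short tuples are padded by zeros. *)
Lemma nongen_le k k' W : (k <= k')%N -> nongen k' W -> nongen k W.
Proof.
move=> kk' ngW w.
have [x Wx] := ngW (fun i => if insub (val i) is Some u then w u else 0).
exists x; apply: contra_not Wx => -[l [z [[a ->] Wz ->]]].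
exists (\sum_i a i *: w i), z.
split=> //; apply: submod_sum => [|i _]; first exact: lincomb_submod.
apply: submodZ; first exact: lincomb_submod.
pose i' := widen_ord kk' i.
have -> : w i = if insub (val i') is Some u then w u else 0 by rewrite /= valK.
exact: (lincomb_gen (fun i : 'I_k' => if insub (val i) is Some u then w u else 0)).
Qed.

(** Over the field [R / ann K0], a subspace that is maximal among those avoiding
    a nonzero vector is a hyperplane. *)
Lemma max_submod_avoid K0 K x : max_submod K0 -> is_submod K -> ann_mul K0 `<=` K ->
  ~ K x -> (forall K', is_submod K' -> K `<=` K' -> ~ K' x -> K' = K) ->
  max_submod K /\ ann K = ann K0.
Proof.
move=> maxK0 sK K0K Kx Kmax; have [sK0 _ _] := maxK0.
suff maxK : max_submod K.
  split=> //; apply/esym/ann_sub_eq => // a K0a z; apply: K0K.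
  exact: ann_mul_gen.
split=> // [|L sL KL]; first by apply/eqP => KT; apply: Kx; rewrite KT.
have [Lx|Lx] := pselect (L x); [right|by left; apply: Kmax].
apply/seteqP; split=> // z _.
have [Kz|Kz] := pselect (K z); first exact: KL.
have sC := cyc_submod z; have sKC := add_submodP sK sC.
have [|KCx] := pselect (add_submod K (cyc z) x); last first.
  have KKC := Kmax _ sKC (add_submodl sC) KCx.
  by case: Kz; rewrite -KKC; apply: add_submodr => //; apply: cyc_id.
move=> [k [_ [Kk [a _ <-] xE]]].
have K0a : ~ ann K0 a.
  move=> K0a; apply: Kx; rewrite xE; apply: submodD => //.
  by apply: K0K; apply: ann_mul_gen.
have [b K0b] := ann_inv maxK0 K0a.
have -> : z = b *: x - b *: k - (b * a - 1) *: z.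
  by rewrite xE scalerDr [_ + b *: _]addrC addrK scalerBl scale1r scalerA subKr.
apply: submodB => //; last by apply: KL; apply: K0K; apply: ann_mul_gen.
by apply: submodB => //; apply: submodZ => //; apply: KL.
Qed.

(** Greedy choice: as long as there are at most [k] vectors, they do not span the
    vector space [E / mE], with [m = ann K0], and one more can be added. *)
Lemma independent_family K0 k : max_submod K0 -> nongen k (ann_mul K0) ->
  exists v : 'I_k.+1 -> E, forall a : 'I_k.+1 -> R,
    ann_mul K0 (\sum_i a i *: v i) -> forall i, ann K0 (a i).
Proof.
move=> maxK0; have [sK0 _ _] := maxK0; have sA := ann_mul_submod K0.
have step k' (v : 'I_k' -> E) : nongen k' (ann_mul K0) ->
    (forall a : 'I_k' -> R, ann_mul K0 (\sum_i a i *: v i) -> forall i, ann K0 (a i)) ->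
    exists v : 'I_k'.+1 -> E, forall a : 'I_k'.+1 -> R,
      ann_mul K0 (\sum_i a i *: v i) -> forall i, ann K0 (a i).
  move=> /(_ v)[x Kx] vI.
  exists (fun i => if unlift ord0 i is Some u then v u else x) => a.
  rewrite big_ord_recl unlift_none; under eq_bigr do rewrite liftK.
  set S := \sum_(i < k') _ => H.
  have [K0a|K0a] := pselect (ann K0 (a ord0)).
    have AS : ann_mul K0 S.
      have := submodD sA (submodN sA (ann_mul_gen x K0a)) H; by rewrite addKr.
    move=> i; case: (unliftP ord0 i) => [u ->|-> //].
    exact: (vI (fun i => a (lift ord0 i)) AS u).
  case: Kx; have [b K0b] := ann_inv maxK0 K0a.
  exists (- (b *: S)), (b *: (a ord0 *: x + S) - (b * a ord0 - 1) *: x); split.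
  - apply: submodN; first exact: lincomb_submod.
    by apply: submodZ; [exact: lincomb_submod | exists (fun i => a (lift ord0 i))].
  - by apply: (submodB sA); [apply: (submodZ sA) | apply: ann_mul_gen].
  - rewrite scalerDr scalerBl scale1r scalerA opprB.
    by rewrite [_ + b *: S]addrC addrA addKr addrC subrK.
elim: k => [ng0|k IH ngk].
  by apply: (step 0%N (fun=> 0)) ng0 _ => a _ [].
have [v vI] := IH (nongen_le (leqnSn k) ngk).
exact: step ngk vI.
Qed.

(** Given independent vectors [v], each choice of scalars [c] in the field with [n]
    elements gives a hyperplane that contains all [v (lift ord0 u) - c u *: v ord0]
    but not [v ord0]; it determines [c]. *)
Lemma many_max_submods K0 k n : max_submod K0 -> nongen k (ann_mul K0) ->
  quot_size K0 n ->
  exists K : {ffun 'I_k -> 'I_n} -> set E, injective K /\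
    forall f, [/\ max_submod (K f), ann (K f) = ann K0 & quot_size (K f) n].
Proof.
move=> maxK0 ngK0 sizeK0; have sA := ann_mul_submod K0.
have [e [esurj eK]] := quot_ann_enum maxK0 sizeK0.
have [r er] := choice esurj.
have [v vI] := independent_family maxK0 ngK0.
have /choice[K HK] (f : {ffun 'I_k -> 'I_n}) : exists K,
    [/\ max_submod K, ann K = ann K0, ~ K (v ord0) &
       forall u, K (v (lift ord0 u) - r (f u) *: v ord0)].
  set w := fun u => v (lift ord0 u) - r (f u) *: v ord0.
  have sw := lincomb_submod w.
  have [|K [sK KL Kv Kmax]] := submod_avoid (add_submodP sw sA) (x := v ord0).
    move=> [_ [z [[a ->] Az v0E]]].
    (* A relation that puts [v ord0] into the span would have the coefficients [b] and,
       by independence, put [1] into the maximal ideal. *)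
    pose b i := if unlift ord0 i is Some u then - a u else 1 + \sum_u a u * r (f u).
    have /vI bK : ann_mul K0 (\sum_i b i *: v i).
      rewrite big_ord_recl /b unlift_none.
      rewrite [X in _ + X](eq_bigr (fun u => - (a u *: v (lift ord0 u)))); last first.
        by move=> u _; rewrite liftK scaleNr.
      rewrite sumrN scalerDl scale1r scaler_suml.
      move: v0E => /(congr1 (fun x => x - \sum_i a i *: w i)).
      rewrite [RHS]addrAC subrr add0r => zE; rewrite -zE in Az.
      congr (ann_mul K0 _): Az; rewrite -addrA; congr (_ + _).
      rewrite -sumrB -sumrN; apply: eq_bigr => u _.
      by rewrite /w scalerBr scalerA opprB.
    apply: (ann1 maxK0).
    have := bK ord0; rewrite /b unlift_none.
    have [sK0 _ _] := maxK0.
    have S0 : ann K0 (\sum_u a u * r (f u)).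
      elim/big_ind: _ => [|x y|u _]; [exact: ann0|exact: annD|apply: annMr].
      have := bK (lift ord0 u); rewrite /b liftK => /(annB sK0 (ann0 sK0)).
      by rewrite sub0r opprK.
    by move=> /annB/(_ S0); rewrite addrK; apply.
  have AK : ann_mul K0 `<=` K by move=> z Az; apply/KL/add_submodr.
  have [maxK annK] := max_submod_avoid maxK0 sK AK Kv Kmax.
  by exists K; split=> // u; apply/KL/add_submodl => //; apply: lincomb_gen.
exists K; split=> [f f' KK|f]; last first.
  have [maxK annK _ _] := HK f; split=> //; apply: ann_quot_enum => //.
  by exists e; split=> // a b; rewrite eK annK.
apply/ffunP => u; rewrite -(er (f u)) -(er (f' u)); apply/eK.
have [maxK <- Kv Kw] := HK f; have [_ _ _ Kw'] := HK f'; rewrite -KK in Kw'.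
have [sK _ _] := maxK.
apply/(annE _ maxK Kv); have := submodB sK (Kw' u) (Kw u).
by rewrite opprB addrC addrA subrK scalerBl.
Qed.

Variables (s : nat) (y : 'I_s -> E).
Hypothesis y_spans : Zspans y.

Lemma lincomb_spans x : lincomb y x.
Proof.
have [c ->] := y_spans x; exists (fun i => (c i)%:~R).
by apply: eq_bigr => i _; rewrite scaler_int.
Qed.

(** One generator [y i0] of [E] is the first whose addition to [L] and the previous
    ones gives everything. For a submodule that contains [L] and the previous
    generators, being proper is the same as avoiding [y i0]. *)
Lemma max_submod_exists L x : is_submod L -> ~ L x ->
  exists2 K, max_submod K & L `<=` K.
Proof.
move=> sL Lx; pose w k (i : 'I_s) := if (i < k)%N then y i else 0.
pose T k := add_submod L (lincomb (w k)).
have sT k : is_submod (T k) by apply: add_submodP => //; apply: lincomb_submod.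
have exT : exists k, `[< forall z, T k z >].
  exists s; apply/asboolP => z; apply: add_submodr => //.
  have [a ->] := lincomb_spans z; exists a.
  by apply: eq_bigr => i _; rewrite /w ltn_ord.
case: (ex_minnP exT) => -[/asboolP T0 _|k /asboolP Tk kmin].
  have [l [_ [Ll [a ->] xE]]] := T0 x; case: Lx; rewrite xE big1 ?addr0 // => i _.
  by rewrite /w ltn0 scaler0.
have [i0 ik] : exists i : 'I_s, i = k :> nat.
  apply: contrapT => /forallNP ik; suff /kmin : `[< forall z, T k z >] by rewrite ltnn.
  apply/asboolP => z; have [l [_ [Ll [a ->] ->]]] := Tk z; exists l.
  exists (\sum_i a i *: w k i); split=> //; first by exists a.
  congr (_ + _); apply: eq_bigr => i _; rewrite /w ltnS leq_eqVlt.
  by have /eqP/negbTE-> := ik i.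
have Ty M : is_submod M -> T k `<=` M -> M (y i0) -> forall z, M z.
  move=> sM TM My z; have [l [_ [Ll [a ->] ->]]] := Tk z.
  apply: submodD => //; first by apply/TM/add_submodl => //; apply: lincomb_submod.
  apply: submod_sum => // i _; apply: submodZ => //.
  rewrite /w ltnS leq_eqVlt; have [ik'|_] /= := eqVneq (i : nat) k.
    by rewrite (_ : i = i0) //; apply: val_inj; rewrite /= ik'.
  case: ifP => ik'; last exact: submod0.
  apply/TM/add_submodr => //; have := lincomb_gen (w k) i; by rewrite /w ik'.
have [|K [sK TK Ky Kmax]] := submod_avoid (sT k) (x := y i0).
  move=> Ty0; have /kmin : `[< forall z, T k z >]; last by rewrite ltnn.
  by apply/asboolP; apply: Ty.
exists K; last by move=> z Lz; apply/TK/add_submodl => //; apply: lincomb_submod.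
split=> // [|M sM KM]; first by apply/eqP => KT; apply: Ky; rewrite KT.
have [My|My] := pselect (M (y i0)); [right|by left; apply: Kmax].
by apply/seteqP; split=> // z _; apply: (Ty M) => //; apply: subset_trans KM.
Qed.

(** Otherwise each [E / mE], with [m] one of the finitely many annihilators that
    contain [q], is generated by [k] elements. The Chinese remainder theorem
    produces [k] elements that do so for all [m] at once. They generate [E / qE]
    because no maximal submodule over [qE] contains them. *)
Lemma nongen_max q k : (0 < q)%N -> nongen k [set q%:R *: z | z in setT] ->
  exists K, [/\ max_submod K, ann K q%:R & nongen k (ann_mul K)].
Proof.
move=> q0 ngq; apply: contrapT => /forallNP H.
pose C : set (set E) := [set K | max_submod K /\ ann K q%:R].
have [|j [K [_ KC Kinj Kex]]] := @ann_exhaust _ _ C (q ^ s).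
  move=> j K KC Kinj; apply: leq_trans (ltnW (ltn_expl j (ltnSn 1))) _.
  have /choice[x Kx] i : exists x, ~ K i x by apply: max_submod_out; case: (KC i).
  apply: (@ann_count _ _ _ _ y_spans q 2 j K (fun i u => x i *+ u)) => //.
  - by move=> i; case: (KC i).
  - by move=> i; case: (KC i).
  have Kx2 i : ~ K i (- x i).
    move=> /(submodN _); rewrite opprK => /(_ (let: And3 sK _ _ := (KC i).1 in sK)).
    exact: Kx.
  move=> i [[|[|//]] hu] [[|[|//]] hv] //=; rewrite ?mulr0n ?mulr1n ?subr0 ?sub0r.
  - by move=> _; apply: val_inj.
  - by move=> /Kx2.
  - by move=> /Kx.
  - by move=> _; apply: val_inj.
have maxK i : max_submod (K i) by case: (KC i).
have /choice[w Hw] i : exists w : 'I_k -> E, forall x,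
    add_submod (lincomb w) (ann_mul (K i)) x.
  have [maxKi Kq] := KC i.
  apply: contrapT => Hw; apply: (H (K i)); split=> // w.
  by apply/existsNP => Hx; apply: Hw; exists w.
have [a Ha] := ann_crt maxK Kinj.
pose W u := \sum_i a i *: w i u.
have sq : is_submod [set q%:R *: z | z in [set: E]].
  split; first by exists 0; rewrite ?scaler0.
  move=> b _ _ [z _ <-] [z' _ <-]; exists (b *: z + z') => //.
  by rewrite scalerDr !scalerA mulrC.
have [x Wx] := ngq W; have sW := lincomb_submod W.
have [M maxM WM] := max_submod_exists (add_submodP sW sq) Wx.
have [sM _ _] := maxM.
have Mq : ann M q%:R by move=> z; apply/WM/add_submodr => //; exists z.
have [i MK] := Kex M (conj maxM Mq).
have AM : ann_mul (K i) `<=` M by apply: ann_mul_sub => //; rewrite MK.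
have [z Mz] := max_submod_out maxM; apply: Mz.
have [l [m [Ll Am ->]]] := Hw i z; apply: submodD => //; last exact: AM.
move: l Ll; apply: lincomb_sub => // u.
have: M (W u) by apply/WM/add_submodl => //; apply: lincomb_gen.
apply: submodBl => //; rewrite /W (bigD1 i) //= addrAC; apply: submodD => //.
  rewrite -[X in _ - X]scale1r -scalerBl; apply: (AM); apply: ann_mul_gen.
  by have := Ha i i; rewrite eqxx.
apply: submod_sum => // i' ii'; apply: (AM); apply: ann_mul_gen.
by have := Ha i' i; rewrite (negbTE ii') subr0.
Qed.

Lemma many_max_submods_prime p k : prime p ->
  nongen k [set p%:R *: z | z in setT] ->
  exists K0 n, [/\ max_submod K0, ann K0 p%:R, nongen k (ann_mul K0), (p <= n)%N &
    exists K : {ffun 'I_k -> 'I_n} -> set E, injective K /\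
    forall f, [/\ max_submod (K f), ann (K f) = ann K0 & quot_size (K f) n]].
Proof.
move=> p_pr ng; have p0 := prime_gt0 p_pr.
have [K0 [maxK0 K0p ngK0]] := nongen_max p0 ng.
have [sK0 _ _] := maxK0.
have [n sizeK0] := quot_size_exists y_spans sK0 p0 K0p.
exists K0, n; split=> //; last exact: many_max_submods.
have := ann_coprime maxK0 K0p (quot_lagrange sK0 sizeK0).
rewrite prime_coprime // negbK; apply: dvdn_leq.
by have [e [_ _]] := sizeK0; case: n e {sizeK0} => // e; case: (e 0).
Qed.

End Hyperplanes.

(** * Isolators and torsion-free rank *)

Section Isolator.
Variables (R : comNzRingType) (E : lmodType R).
Implicit Types (W : set E).

Definition isolator W : set E := [set x | exists2 D, (0 < D)%N & W (D%:R *: x)].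

Lemma isolator_submod W : is_submod W -> is_submod (isolator W).
Proof.
move=> sW; split=> [|a x z [D D0 Wx] [D' D'0 Wz]].
  by exists 1%N => //; rewrite scaler0; apply: submod0.
exists (D * D')%N; first by rewrite muln_gt0 D0.
rewrite (_ : _ *: _ = (D'%:R * a) *: (D%:R *: x) + D%:R *: (D'%:R *: z)).
  by apply: submodD => //; apply: submodZ.
by rewrite scalerDr !scalerA natrM -mulrA [in LHS]mulrC.
Qed.

Lemma isolator_int W x (m : int) : is_submod W -> m != 0 -> W (x *~ m) -> isolator W x.
Proof.
move=> sW m0 Wx; exists `|m|%N; first by rewrite absz_gt0.
rewrite scaler_nat pmulrn abszE; have [_|_] := ger0P m; first by [].
by rewrite mulrNz; apply: submodN.
Qed.

Variables (s : nat) (y : 'I_s -> E).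
Hypothesis y_spans : Zspans y.

Lemma isolator_uniform W : is_submod W -> (forall i, isolator W (y i)) ->
  exists2 D, (0 < D)%N & forall x, W (D%:R *: x).
Proof.
move=> sW Wy; have /choice[D HD] i : exists D, (0 < D)%N /\ W (D%:R *: y i).
  by have [D] := Wy i; exists D.
exists (\prod_i D i)%N; first by apply: prodn_gt0 => i; case: (HD i).
move=> x; have [a ->] := lincomb_spans y_spans x.
rewrite scaler_sumr; apply: submod_sum => // i _.
rewrite scalerA mulrC -scalerA; apply: submodZ => //.
rewrite (bigD1 i) //= natrM mulrC -scalerA; apply: submodZ => //.
by case: (HD i).
Qed.

(** The determinant trick: modulo [W] the generators of [E] satisfy a square
    system with matrix [1 - p A], whose determinant is [1] modulo [p], hence
    nonzero, and kills [E / W]. *)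
Lemma isolator_mod p W : is_submod W -> (1 < p)%N ->
  (forall x, add_submod W [set p%:R *: z | z in setT] x) ->
  exists2 D, (0 < D)%N & forall x, W (D%:R *: x).
Proof.
move=> sW p1 Wp.
have /choice[w Hw] i : exists w, W w /\ exists c : 'I_s -> int,
    y i = w + (\sum_k y k *~ c k) *+ p.
  have [w [_ [Ww [z _ <-] ->]]] := Wp (y i); exists w; split=> //.
  by have [c ->] := y_spans z; exists c; rewrite scaler_nat.
have /choice[c Hc] i : exists c : 'I_s -> int,  y i = w i + (\sum_k y k *~ c k) *+ p.
  by case: (Hw i).
pose B : 'M[int]_s := \matrix_(i, k) ((i == k)%:R - c i k *+ p).
have BW i : \sum_k y k *~ B i k = w i.
  under eq_bigr do rewrite mxE mulrzBr.
  rewrite sumrB (bigD1 i) //= eqxx mulr1z big1 ?addr0; last first.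
    by move=> k /negbTE; rewrite eq_sym => ->; rewrite mulr0z.
  rewrite -[RHS](addrK ((\sum_k y k *~ c i k) *+ p)) -Hc -sumrMnl.
  congr (_ - _); apply: eq_bigr => k _.
  by rewrite -mulr_natr natz mulrzA -pmulrn.
have detW i : W (y i *~ \det B).
  have -> : y i *~ \det B = \sum_k w k *~ (\adj B) i k.
    transitivity (\sum_j y j *~ (\adj B *m B) i j).
      rewrite mul_adj_mx (bigD1 i) //= !mxE eqxx big1 ?addr0 // => j /negbTE.
      by rewrite !mxE eq_sym => ->; rewrite mulr0z.
    transitivity (\sum_j \sum_k y j *~ (\adj B i k * B k j)).
      by apply: eq_bigr => j _; rewrite mxE mulrz_sumr.
    rewrite exchange_big; apply: eq_bigr => k _; rewrite -BW mulrz_suml.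
    by apply: eq_bigr => j _; rewrite mulrC mulrzA.
  apply: submod_sum => // k _; apply: submodMz => //; by case: (Hw k).
have det0 : \det B != 0.
  apply/eqP => detB; have /eqP := oner_neq0 'Z_p; apply.
  have : \det (map_mx intr B : 'M['Z_p]_s) = 0 by rewrite det_map_mx detB.
  rewrite (_ : map_mx _ _ = 1%:M) ?det1 //.
  apply/matrixP => i k; rewrite !mxE rmorphB !rmorphMn /= -[X in _ - X]mulr_natr.
  by rewrite (pchar_Zp p1) mulr0 subr0; case: (i == k).
by apply: isolator_uniform => // i; apply: isolator_int (detW i).
Qed.
End Isolator.

Lemma rat_common_denom k (u : 'I_k -> rat) : exists2 D : int, D != 0 &
  exists c : 'I_k -> int, forall j, u j * D%:~R = (c j)%:~R.
Proof.
exists (\prod_i denq (u i)); first by apply/prodf_neq0 => i _; apply: denq_neq0.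
exists (fun j => numq (u j) * \prod_(i | i != j) denq (u i)) => j.
rewrite (bigD1 j) //= !rmorphM /= -{1}(divq_num_den (u j)) mulrA divfK //.
by rewrite intr_eq0 denq_neq0.
Qed.

(** A system with more unknowns than equations has a nonzero integral solution. *)
Lemma int_kernel k e (M : 'M[int]_(k, e)) : (e < k)%N ->
  exists2 c : 'I_k -> int, (exists j, c j != 0) & forall i, \sum_j c j * M j i = 0.
Proof.
move=> ek; pose Mq := map_mx intr M : 'M[rat]_(k, e).
have : kermx Mq != 0.
  rewrite -mxrank_eq0 mxrank_ker subn_eq0 -ltnNge.
  exact: leq_ltn_trans (rank_leq_col _) ek.
move=> /rowV0Pn[u /sub_kermxP uM /rV0Pn[j uj]].
have [D D0 [c Hc]] := rat_common_denom (u 0).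
exists c.
  exists j; rewrite -(intr_eq0 rat) -Hc mulf_neq0 // intr_eq0 //.
move=> i; apply/eqP; rewrite -(intr_eq0 rat) rmorph_sum /=; apply/eqP.
transitivity ((u *m Mq) 0 i * D%:~R); last by rewrite uM mxE mul0r.
rewrite mxE mulr_suml; apply: eq_bigr => k' _.
by rewrite rmorphM /= -Hc !mxE mulrAC.
Qed.

Section TorsionFreeRank.
Variable A : zmodType.

Lemma Zfree_le k e (v : 'I_k -> A) (w : 'I_e -> A) D : (0 < D)%N -> Zfree v ->
  (forall j, exists c : 'I_e -> int, v j *+ D = \sum_i w i *~ c i) -> (k <= e)%N.
Proof.
move=> D0 vfree /choice[M HM]; rewrite leqNgt; apply/negP => ek.
have [c [j cj] Hc] := int_kernel (\matrix_(j, i) M j i) ek.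
have /vfree/(_ j)/eqP : \sum_j v j *~ (c j * D%:Z) = 0.
  under eq_bigr do rewrite mulrC mulrzA -pmulrn HM mulrz_suml.
  rewrite exchange_big /= big1 // => i _.
  under eq_bigr do rewrite -mulrzA mulrC.
  rewrite -mulrz_sumr; have := Hc i; under eq_bigr do rewrite mxE.
  by move=> ->; rewrite mulr0z.
by rewrite mulf_eq0 (negbTE cj) /= => /eqP[] ?; lia.
Qed.

Variables (s : nat) (y : 'I_s -> A).
Hypothesis y_spans : Zspans y.

(** Adding a generator to a free family of maximal length makes it dependent, so
    some nonzero multiple of the generator is in the span of the family. *)
Lemma tf_rank_span r : is_tf_rank A r ->
  exists v : 'I_r -> A, Zfree v /\ exists2 D, (0 < D)%N &
    forall x, exists c : 'I_r -> int, x *+ D = \sum_i v i *~ c i.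
Proof.
move=> [[v vfree] rmax]; exists v; split=> //.
pose W : set (zmodule A) := lincomb (v : 'I_r -> zmodule A).
have sW : is_submod W by apply: lincomb_submod.
have [|D D0 HD] := @isolator_uniform _ _ s (y : 'I_s -> zmodule A) y_spans _ sW.
  move=> i.
  pose v' j := if unlift ord0 j is Some u then v u else y i.
  have /existsNP[c /not_implyP[c0 /existsNP[j cj]]] : ~ Zfree v'.
    by move=> /rmax; rewrite ltnn.
  move: c0; rewrite big_ord_recl {1}/v' unlift_none => c0.
  have {}c0 : y i *~ c ord0 + \sum_u v u *~ c (lift ord0 u) = 0.
    rewrite -[RHS]c0; congr (_ + _); apply: eq_bigr => u _.
    by rewrite /v' liftK.
  have [c00|c00] := eqVneq (c ord0) 0.
    rewrite c00 mulr0z add0r in c0; have := vfree _ c0.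
    case: (unliftP ord0 j) => [u|] jE; rewrite jE // in cj.
    by move=> /(_ u)/cj.
  apply: isolator_int c00 _ => //.
  exists (fun u => - c (lift ord0 u)); move/eqP: c0; rewrite addr_eq0 => /eqP c0.
  apply: (etrans c0).
  by rewrite -sumrN; apply: eq_bigr => u _; rewrite -[RHS]scalezrE scaleNr scalezrE.
exists D => // x; have [c Hc] := HD x; exists c.
rewrite -[LHS]/((x : zmodule A) *+ D) -scaler_nat Hc.
by apply: eq_bigr => i _; rewrite scalezrE.
Qed.

Lemma tf_rank_exists : exists r, is_tf_rank A r.
Proof.
pose P r := `[< exists v : 'I_r -> A, Zfree v >].
have P0 : exists r, P r by exists 0%N; apply/asboolP; exists (fun=> 0) => c _ [].
have Ps r : P r -> (r <= s)%N.
  by move=> /asboolP[v vfree]; apply: (@Zfree_le _ _ v y 1) => // j; apply: y_spans.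
case: (ex_maxnP P0 Ps) => r /asboolP[v vfree] rmax; exists r.
split; first by exists v.
by move=> k w wfree; apply: rmax; apply/asboolP; exists w.
Qed.

(** The coordinate functions with respect to a maximal free family are additive,
    and vanish together only on torsion elements. *)
Lemma separating_functional (x : A) : (forall D, (0 < D)%N -> x *+ D != 0) ->
  exists2 f : A -> int, {morph f : a b / a + b} & f x != 0.
Proof.
have [r /tf_rank_span[v [vfree [D D0 /choice[c Hc]]]]] := tf_rank_exists.
move=> /(_ D D0) xD.
have [i ci] : exists i, c x i != 0.
  apply: contrapT => /forallNP cx; move/eqP: xD; apply; rewrite Hc big1 // => i _.
  by have /negP := cx i; rewrite negbK => /eqP->; rewrite mulr0z.
exists (fun z => c z i) => // a b; apply/eqP; rewrite -subr_eq0; apply/eqP.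
apply: (vfree (fun j => c (a + b) j - (c a j + c b j))).
under eq_bigr do rewrite mulrzBr mulrzDr.
by rewrite sumrB big_split /= -!Hc mulrnDl subrr.
Qed.

(** An additive [f] to the integers extends to the tensor product with the
    rationals, so that [x] must vanish under all such [f]. *)
Lemma tens1_eq0 (x : A) : tens (1 : rat) x = 0 -> exists2 D, (0 < D)%N & x *+ D = 0.
Proof.
move=> x0; apply: contrapT => H.
have [|f fD fx] := @separating_functional x.
  by move=> D D0; apply/eqP => xD; apply: H; exists D.
have FDl a b z : (a + b) * (f z)%:~R = a * (f z)%:~R + b * (f z)%:~R :> rat.
  exact: mulrDl.
have FDr a z z' : a * (f (z + z'))%:~R = a * (f z)%:~R + a * (f z')%:~R :> rat.
  by rewrite fD intrD mulrDr.
have := tens_lift_tens FDl FDr 1 x; rewrite x0.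
have := tens_liftB FDl FDr 0 0; rewrite subr0 => ->; rewrite subrr mul1r.
by move/esym/eqP; rewrite intr_eq0 (negbTE fx).
Qed.

End TorsionFreeRank.

(** * Additive maps and additive subgroups *)

Section AdditiveMaps.
Variables (A B : zmodType) (f : A -> B).
Hypothesis fD : forall x z, f (x + z) = f x + f z.

Lemma additive_map0 : f 0 = 0.
Proof. by apply: (addrI (f 0)); rewrite -fD !addr0. Qed.

Lemma additive_mapB x z : f (x - z) = f x - f z.
Proof. by apply: (addIr (f z)); rewrite -fD !subrK. Qed.

Lemma additive_mapN x : f (- x) = - f x.
Proof. by rewrite -sub0r additive_mapB additive_map0 sub0r. Qed.

Lemma additive_mapMn x n : f (x *+ n) = f x *+ n.
Proof. by elim: n => [|n IH]; rewrite ?additive_map0 // !mulrS fD IH. Qed.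

Lemma additive_mapMz x (m : int) : f (x *~ m) = f x *~ m.
Proof.
case: m => n; first exact: additive_mapMn.
by rewrite NegzE !mulrNz additive_mapN -!pmulrn additive_mapMn.
Qed.

Lemma additive_sum k (v : 'I_k -> A) (c : 'I_k -> int) :
  f (\sum_i v i *~ c i) = \sum_i f (v i) *~ c i.
Proof.
rewrite (big_morph f fD additive_map0).
by apply: eq_bigr => i _; apply: additive_mapMz.
Qed.

End AdditiveMaps.

Lemma subB_closed (A : zmodType) (W : set A) : W 0 ->
  (forall x z, W x -> W z -> W (x - z)) ->
  (forall x z, W x -> W z -> W (x + z)) /\ (forall x (m : int), W x -> W (x *~ m)).
Proof.
move=> W0 WB; have WN x : W x -> W (- x) by move=> Wx; rewrite -sub0r; apply: WB.
have WD x z : W x -> W z -> W (x + z).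
  by move=> Wx Wz; rewrite -[z]opprK; apply: WB => //; apply: WN.
split=> // x m Wx; elim/int_ind: m => [|n IH|n IH]; first by rewrite mulr0z.
  by rewrite intS mulrzDr mulr1z; apply: WD.
by rewrite intS opprD mulrzDr mulrN1z; apply: WD => //; apply: WN.
Qed.

(** * Rational scalars *)

Lemma mpoly_submod (A : comNzRingType) l (M : lmodType (mpoly l A)) (W : set M) :
  W 0 -> (forall x y, W x -> W y -> W (x + y)) ->
  (forall c x, W x -> W (mpolyC l c *: x)) ->
  (forall i x, W x -> W (mpolyX A (mnm1 i) *: x)) -> is_submod W.
Proof.
move=> W0 WD WC WX; split=> // a x z Wx Wz; apply: (WD) => //.
rewrite (mpolyE a) scaler_suml; apply: (big_ind W W0 WD) => m _.
rewrite -mul_mpolyC -scalerA; apply: WC; rewrite mpolyXE_id.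
elim/big_rec: _ => [|i b _ IH]; first by rewrite scale1r.
rewrite -scalerA; elim: (m i) => [|k IHk]; first by rewrite expr0 scale1r.
by rewrite exprS -scalerA; apply: WX.
Qed.

Section RationalModule.
Variables (l : nat) (M : lmodType (mpoly l int)).
Implicit Types (x z : M) (t : tensor rat M).

Lemma tens0 (a : rat) : tens a (0 : M) = 0.
Proof. exact: additive_map0 (tensDr a). Qed.

Lemma tensN (a : rat) x : tens a (- x) = - tens a x.
Proof. exact: additive_mapN (tensDr a) x. Qed.

Lemma tens1Mz x (m : int) : tens (1 : rat) (x *~ m) = (m%:~R : rat) *: tens 1 x.
Proof. by rewrite (additive_mapMz (tensDr 1)) scaler_int. Qed.

Lemma rat_clear (c : rat) : (0 < `|denq c|)%N /\ (`|denq c|%:R * c = (numq c)%:~R).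
Proof.
split; first by rewrite absz_gt0 denq_neq0.
rewrite pmulrn gez0_abs ?denq_ge0 // -{2}(divq_num_den c) mulrC divfK //.
by rewrite intr_eq0 denq_neq0.
Qed.

(** Every tensor is a fraction. *)
Lemma tensor_clear t : exists D, (0 < D)%N /\ exists x, (D%:R : rat) *: t = tens 1 x.
Proof.
elim/tens_ind: t => [a x|t t' [D [D0 [x Hx]]] [D' [D'0 [x' Hx']]]].
  have [D0 Da] := rat_clear a; exists `|denq a|%N; split=> //.
  by exists (x *~ numq a); rewrite tensZ Da tens1Mz tensZ mulr1.
exists (D * D')%N; split; first by rewrite muln_gt0 D0.
exists (x *~ D' - x' *~ D).
rewrite tensDr tensN !tens1Mz -Hx -Hx' !scalerA scalerBr natrM -!pmulrn.
by rewrite [D%:R * D'%:R]mulrC [X in _ - X *: _]mulrC.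
Qed.

Lemma rat_scaleC (c : rat) (t : rat_mod M) : mpolyC l c *: t = c *: (t : tensor rat M).
Proof. exact (polymod_scaleC (phiC := @rat_var_actC l M) c t). Qed.

Lemma rat_scaleX i x : mpolyX rat (mnm1 i) *: (tens 1 x : rat_mod M) =
  tens 1 (mpolyX int (mnm1 i) *: x).
Proof. by rewrite polymod_scaleX /= tens_map_tens. Qed.

Variables (s : nat) (y : 'I_s -> M).
Hypothesis y_spans : Zspans y.

(** Generators of the rational module can be scaled to come from [M]. *)
Lemma rat_gens d : is_min_gens (rat_mod M) d -> exists (v : 'I_d -> M) D, (0 < D)%N /\
  forall x, lincomb v (D%:R *: x).
Proof.
move=> [[w wspan] _].
have /choice[v Hv] i : exists v, exists2 D, (0 < D)%N &
    (D%:R : rat) *: (w i : tensor rat M) = tens 1 v.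
  by have [D [D0 [v Hv]]] := tensor_clear (w i); exists v, D.
have sv := lincomb_submod v; exists v.
pose W : set (rat_mod M) := [set t : tensor rat M | exists2 D, (0 < D)%N &
  exists2 z, lincomb v z & (D%:R : rat) *: t = tens 1 z].
have sW : is_submod W.
  apply: mpoly_submod.
  - by exists 1%N => //; exists 0; rewrite ?scaler0 ?tens0 //; apply: submod0.
  - move=> t t' [D D0 [z vz tz]] [D' D'0 [z' vz' tz']].
    exists (D * D')%N; first by rewrite muln_gt0 D0.
    exists (z *~ D' + z' *~ D); first by apply: submodD => //; apply: submodMz.
    rewrite tensDr !tens1Mz -tz -tz' !scalerA scalerDr natrM -!pmulrn.
    by rewrite [D%:R * D'%:R]mulrC [X in _ + X *: _]mulrC.
  - move=> c t [D D0 [z vz tz]]; have [b0 bc] := rat_clear c.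
    exists (D * `|denq c|)%N; first by rewrite muln_gt0 D0.
    exists (z *~ numq c); first exact: submodMz.
    by rewrite rat_scaleC scalerA natrM -mulrA bc mulrC -scalerA tz tens1Mz.
  - move=> i t [D D0 [z vz tz]]; exists D => //.
    exists (mpolyX int (mnm1 i) *: z); first exact: submodZ.
    by rewrite -rat_scaleX -tz -!rat_scaleC !scalerA mulrC.
have [|D D0 HD] := @isolator_uniform _ _ _ _ y_spans _ sv; last by exists D.
move=> k; have : W (tens 1 (y k)).
  have : submod_span (range w) (tens 1 (y k)) by rewrite wspan.
  apply: smallest_sub => // _ [i _ <-]; have [D D0 wD] := Hv i.
  by exists D => //; exists (v i) => //; apply: lincomb_gen.
move=> [D D0 [z vz tz]].
have : tens (1 : rat) (y k *+ D - z) = 0.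
  by rewrite tensDr tensN -tz pmulrn tens1Mz -pmulrn subrr.
move=> /(tens1_eq0 y_spans)[D' D'0 H]; exists (D' * D)%N; first by rewrite muln_gt0 D'0.
rewrite natrM -scalerA !scaler_nat -[_ *+ D](subrK z) mulrnDl H add0r.
by rewrite -scaler_nat; apply: submodZ.
Qed.

Lemma rat_span k (v : 'I_k -> M) : (forall x, isolator (lincomb v) x) ->
  submod_span (range (fun i => tens 1 (v i) : rat_mod M)) = setT.
Proof.
move=> vx; set W := submod_span _; have sW : is_submod W by apply: span_submod.
have sP : is_submod [set x | W (tens 1 x)].
  apply: mpoly_submod => [|x z Wx Wz|c x Wx|i x Wx] /=.
  - by rewrite tens0; exact (submod0 sW).
  - by rewrite tensDr; exact (submodD sW Wx Wz).
  - rewrite -[c]intz rmorph_int scaler_int tens1Mz -rat_scaleC.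
    exact (submodZ sW _ Wx).
  - by rewrite -rat_scaleX; exact (submodZ sW _ Wx).
have WZ (a : rat) x : W (tens 1 x) -> W (tens a x).
  by move=> Wx; rewrite -[a]mulr1 -tensZ -rat_scaleC; exact (submodZ sW _ Wx).
apply/seteqP; split=> // t _; elim/tens_ind: t => [a x|t t' Wt Wt']; last first.
  exact (submodB sW Wt Wt').
apply: WZ; have [D D0 vD] := vx x.
have : W (tens 1 (D%:R *: x)).
  move: (D%:R *: x) vD; apply: (lincomb_sub sP) => i /=.
  by apply: Defs.sub_span; exists i.
rewrite scaler_nat pmulrn tens1Mz tensZ mulr1 => WD.
have -> : tens (1 : rat) x = (D%:R^-1 : rat) *: tens D%:R x.
  by rewrite tensZ mulVf // pnatr_eq0 -lt0n.
by rewrite -rat_scaleC; exact (submodZ sW _ WD).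
Qed.

(** By the determinant trick, generators of [M] modulo [p] generate a submodule
    of finite index, hence also the rational module. *)
Lemma rat_nongen p k : (1 < p)%N -> is_min_gens (rat_mod M) k.+1 ->
  nongen k [set p%:R *: z | z in [set: M]].
Proof.
move=> p1 [_ kmin] v; apply: contrapT => /forallNP H.
have sv := lincomb_submod v.
have [|D D0 HD] := isolator_mod y_spans sv p1.
  by move=> x; apply: contrapT; apply: H.
have /kmin : submod_span (range (fun i => tens 1 (v i) : rat_mod M)) = setT.
  by apply: rat_span => x; exists D.
by rewrite ltnn.
Qed.

End RationalModule.

(** * Subgroups, cosets, quotients *)

Section Subgroups.
Variables (G : groupType) (H : set G).
Hypothesis sH : is_subgroup H.

Lemma subg1 : H 1%g. Proof. by case: sH. Qed.

Lemma subgV x : H x -> H x^-1%g.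
Proof. by move=> Hx; rewrite -[(x^-1)%g]mul1g; apply: sH.2 => //; apply: subg1. Qed.

Lemma subgM x y : H x -> H y -> H (x * y)%g.
Proof. by move=> Hx Hy; rewrite -[y]invgK; apply: sH.2 => //; apply: subgV. Qed.

Lemma subgMl x y : H x -> H (x * y)%g -> H y.
Proof. by move=> Hx Hxy; rewrite -[y](mulKg x); apply: subgM => //; apply: subgV. Qed.

Lemma subgMr x y : H y -> H (x * y)%g -> H x.
Proof. by move=> Hy Hxy; rewrite -[x](mulgK y); apply: subgM => //; apply: subgV. Qed.

Lemma coset_eq x y :
  [set (x * h)%g | h in H] = [set (y * h)%g | h in H] <-> H (x^-1 * y)%g.
Proof.
split=> [xy|Hxy].
  have : [set (y * h)%g | h in H] y by exists 1%g; rewrite ?mulg1 //; apply: subg1.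
  by rewrite -xy => -[h Hh <-]; rewrite mulKg.
apply/seteqP; split=> _ [h Hh <-].
  exists (y^-1 * x * h)%g; last by rewrite !mulgA mulgV mul1g.
  by apply: subgM => //; rewrite -[x]invgK -invgM; apply: subgV.
exists (x^-1 * y * h)%g; last by rewrite !mulgA mulgV mul1g.
exact: subgM.
Qed.

Lemma has_indexP n :
  has_index H n <-> exists e : G -> 'I_n, enumerates (fun x y => H (x^-1 * y)%g) e.
Proof.
split=> [/card_set_bijP[f [fI finj fsurj]]|[e [esurj eH]]].
  have fn x : (f [set (x * h)%g | h in H] < n)%N by apply: fI; exists x.
  exists (fun x => Ordinal (fn x)); split=> [i|x y].
    have [_ [x ->] fx] := fsurj i (ltn_ord i).
    by exists x; apply: val_inj.
  rewrite -coset_eq; split=> [[]|xy]; last by apply: val_inj; rewrite /= xy.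
  by move/finj; apply; apply/mem_set; [exists x | exists y].
have [r er] := choice esurj.
rewrite /has_index card_eq_sym; apply/card_set_bijP.
exists (fun i => if insub i is Some u then [set (r u * h)%g | h in H] else set0).
split=> [i /= ilt|i k /set_mem /= ilt /set_mem /= klt|_ [x ->]].
- by rewrite insubT; exists (r (Sub i ilt)).
- by rewrite !insubT => /coset_eq/eH; rewrite !er => /(congr1 val).
exists (e x); first exact: ltn_ord.
rewrite /= valK.
by apply/coset_eq => //; apply/eH; rewrite er.
Qed.

End Subgroups.

Section Projection.
Variables (G : groupType) (N : normal_subgroup G).

Definition proj (x : G) : quotg N := \pi_(quotg N) x.

Lemma projM x y : proj (x * y)%g = (proj x * proj y)%g.
Proof. exact: pi_quotgM. Qed.

Lemma projV x : proj x^-1%g = ((proj x)^-1)%g.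
Proof. exact: pi_quotgV. Qed.

Lemma proj1 : proj 1%g = 1%g. Proof. by []. Qed.

Lemma proj_eq x y : proj x = proj y <-> nsub_set N (x^-1 * y)%g.
Proof.
split=> [/eqmodP /= /asboolP //|Nxy].
by apply/eqmodP => /=; apply/asboolP.
Qed.

Lemma proj_eq1 x : proj x = 1%g <-> nsub_set N x.
Proof.
rewrite -proj1; split=> [/esym|] H; [|apply/esym]; move: H;
  by rewrite proj_eq invg1 mul1g.
Qed.

Lemma projK q : proj (repr q) = q. Proof. exact: reprK. Qed.

End Projection.

Lemma gen_subgroup_all (G : groupType) (S : set G) (H : set G) :
  gen_subgroup S = setT -> is_subgroup H -> S `<=` H -> forall x, H x.
Proof.
move=> genS sH SH x; have : gen_subgroup S x by rewrite genS.
by apply: smallest_sub.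
Qed.

Lemma Zspans_gen (A : groupType) (abA : abelian_group A) k (v : 'I_k -> A) :
  gen_subgroup (range v) = setT -> Zspans (v : 'I_k -> addg abA).
Proof.
move=> genv x.
apply: (gen_subgroup_all (H := [set x : A |  exists c : 'I_k -> int,
   (x : addg abA) = \sum_i (v i : addg abA) *~ c i])) genv _ _ x.
  split; first by exists (fun=> 0); rewrite big1.
  move=> _ _ [c ->] [c' ->]; exists (fun i => c i - c' i).
  transitivity (\sum_i (v i : addg abA) *~ c i - \sum_i (v i : addg abA) *~ c' i).
    by [].
  by rewrite -sumrB; apply: eq_bigr => i _; rewrite mulrzBr.
move=> _ [i _ <-]; exists (fun j => (j == i)%:R).
by rewrite (bigD1 i) //= eqxx mulr1z big1 ?addr0 // => j /negbTE->; rewrite mulr0z.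
Qed.

(** * The abelianization *)

Lemma int_submod (E : lmodType int) (W : set E) :
  W 0 -> (forall x z, W x -> W z -> W (x - z)) -> is_submod W.
Proof.
move=> W0 WB; have [WD WM] := subB_closed W0 WB.
split=> // a x z Wx Wz; apply: WD => //.
by rewrite -[a]intz scaler_int; apply: WM.
Qed.

Section Abelianization.
Variable G : groupType.

Definition derived_set : set G :=
  gen_subgroup [set z | exists x y, z = [~ x, y]%g].

Lemma derived_subgroup : is_subgroup derived_set.
Proof.
split=> [H [[H1 _] _]|x y Dx Dy H HS] //.
by have [[_ HV] _] := HS; apply: HV; [apply: Dx | apply: Dy].
Qed.

Lemma derived_comm x y : derived_set [~ x, y]%g.
Proof. by move=> H [_]; apply; exists x, y. Qed.

Lemma derived_normal x y : derived_set x -> derived_set (x ^ y)%g.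
Proof.
have sD := derived_subgroup.
have -> : (x ^ y)%g = (x * [~ x, y])%g by rewrite commgEl mulVKg.
by move=> Dx; apply: (subgM sD) => //; apply: derived_comm.
Qed.

Definition derived := NormalSubgroup derived_subgroup derived_normal.

Lemma derived_abelian : abelian_group (quotg derived).
Proof.
move=> p q; rewrite -(projK p) -(projK q); set x := repr p; set y := repr q.
rewrite /commute -!projM; apply/proj_eq.
have -> : ((x * y)^-1 * (y * x))%g = [~ y, x]%g.
  by rewrite commgEl conjgE invgM !mulgA.
exact: derived_comm.
Qed.

Definition abelianization : lmodType int := zmodule (addg derived_abelian).

Definition ab (x : G) : abelianization := proj derived x.

Lemma abM x y : ab (x * y)%g = ab x + ab y.
Proof. exact: projM. Qed.

Lemma abV x : ab x^-1%g = - ab x.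
Proof. exact: projV. Qed.

Lemma ab1 : ab 1%g = 0. Proof. by []. Qed.

Lemma ab_surj z : exists x, ab x = z.
Proof. by exists (repr (z : quotg derived)); apply: projK. Qed.

Lemma ab_eq x y : ab x = ab y <-> derived_set (x^-1 * y)%g.
Proof. exact: proj_eq. Qed.

(** The universal property of the abelianization. *)
Lemma ab_lift (A : zmodType) (f : G -> A) : (forall x y, f (x * y)%g = f x + f y) ->
  exists2 h : abelianization -> A, (forall z z', h (z + z') = h z + h z') &
    forall x, h (ab x) = f x.
Proof.
move=> fM; have f1 : f 1%g = 0 by apply: (addrI (f 1%g)); rewrite -fM mulg1 addr0.
have fV x : f x^-1%g = - f x.
  by apply/eqP; rewrite -addr_eq0 -fM mulVg f1.
have fD x : derived_set x -> f x = 0.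
  apply: (@smallest_sub _ _ _ [set x | f x = 0]) => /=.
    by split=> // u v /= fu fv; rewrite fM fV fu fv subrr.
  move=> _ [u [v ->]] /=; rewrite commgEl conjgE !fM !fV.
  by rewrite [f u + f v]addrC !addKr addNr.
have [r rE] := choice ab_surj.
have frE x : f (r (ab x)) = f x.
  have /ab_eq/fD : ab x = ab (r (ab x)) by rewrite rE.
  by rewrite fM fV addrC => /subr0_eq.
exists (f \o r) => // z z'; rewrite -(rE z) -(rE z') -abM /=.
by rewrite !frE fM.
Qed.

Implicit Type K : set abelianization.

Definition ab_preim K : set G := [set x | K (ab x)].

Lemma ab_preim_subgroup K : is_submod K -> is_subgroup (ab_preim K).
Proof.
move=> sK; split=> [|x y Kx Ky]; first exact: (submod0 sK).
by rewrite /ab_preim /= abM abV; apply: (submodB sK).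
Qed.

Lemma ab_preim_exists (M : set G) : is_subgroup M -> derived_set `<=` M ->
  exists2 K, is_submod K & M = ab_preim K.
Proof.
move=> sM DM; have KE x : (exists2 x', ab x' = ab x & M x') <-> M x.
  split=> [[x' /ab_eq/DM Mx Mx']|Mx]; last by exists x.
  by rewrite -[x](mulVKg x'); apply: subgM.
exists [set z | exists2 x, ab x = z & M x]; last first.
  by apply/seteqP; split=> x /KE.
apply: int_submod => [|_ _ [x <- Mx] [z <- Mz]].
  by exists 1%g; rewrite ?ab1 //; apply: subg1.
by exists (x * z^-1)%g; [rewrite abM abV | apply: sM.2].
Qed.

Lemma ab_preim_sub K L : ab_preim K `<=` ab_preim L -> K `<=` L.
Proof. by move=> KL z; have [x <-] := ab_surj z; apply: KL. Qed.

Lemma ab_preim_inj : injective ab_preim.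
Proof. by move=> K L KL; apply/seteqP; split; apply: ab_preim_sub; rewrite KL. Qed.

Lemma ab_preim_derived K : is_submod K -> derived_set `<=` ab_preim K.
Proof.
move=> sK x Dx; rewrite /ab_preim /=.
have <- : ab 1%g = ab x by apply/ab_eq; rewrite invg1 mul1g.
by rewrite ab1; apply: (submod0 sK).
Qed.

Lemma ab_preim_max K : is_submod K ->
  is_maximal_subgroup (ab_preim K) <-> max_submod K.
Proof.
move=> sK; split=> [[sM MT Mmax]|[_ KT Kmax]]; split=> //.
- by apply: contra_neq MT => ->.
- move=> L sL KL; have [||LK|LT] := Mmax (ab_preim L).
  + exact: ab_preim_subgroup.
  + by move=> x; apply: KL.
  + by left; apply: ab_preim_inj.
  + right; apply/seteqP; split=> // z _; have [x <-] := ab_surj z.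
    by have : setT x by []; rewrite -LT.
- exact: ab_preim_subgroup.
- apply: contra_neq KT => KT; apply/seteqP; split=> // z _.
  by have [x <-] := ab_surj z; have : setT x by []; rewrite -KT.
- move=> H sH KH; have [|L sL HL] := ab_preim_exists sH.
    by apply: subset_trans KH; apply: ab_preim_derived.
  rewrite HL in KH *; have [->|->] := Kmax L sL (ab_preim_sub KH); first by left.
  by right.
Qed.

Lemma ab_preim_index K n : is_submod K ->
  has_index (ab_preim K) n <-> quot_size K n.
Proof.
move=> sK; have sM := ab_preim_subgroup sK; rewrite (has_indexP sM).
have KE x y : ab_preim K (x^-1 * y)%g <-> K (ab x - ab y).
  rewrite /ab_preim /= abM abV addrC; split; exact: (submodBC sK).
split=> -[e [esurj eK]].
  have [r rE] := choice ab_surj.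
  exists (e \o r); split=> [i|z z'] /=; last by rewrite eK KE !rE.
  have [x <-] := esurj i; exists (ab x); apply/eK/KE.
  by rewrite rE subrr; apply: (submod0 sK).
exists (e \o ab); split=> [i|x y] /=; last by rewrite eK KE.
by have [z <-] := esurj i; have [x <-] := ab_surj z; exists x.
Qed.

End Abelianization.
Arguments derived_set G : clear implicits.

(** * Maximal subgroups and the conjugation module *)

Section ConjugationModule.
Variables (G : groupType) (N : normal_subgroup G).
Hypotheses (abN : abelian_group (nsub N)) (abQ : abelian_group (quotg N)).
Variables (l0 : nat) (g : 'I_l0 -> quotg N).
Hypothesis gen_g : gen_subgroup (range g) = setT.

Local Notation E := (conj_mod abN abQ g).
Local Notation gX i := (mpolyX int (mnm1 i)).
Implicit Types (x z : E) (h m : G) (K L : set E) (M H : set G) (n : nat).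

(** Elements of the conjugation module as elements of [G], and the action of all
    of [G] on this module, which does not refer to the variables [gX i]. *)
Definition emb x : G := val (x : nsub N).
Definition act h x : E := conj_nsub h (x : nsub N).

Lemma embD x z : emb (x + z) = (emb x * emb z)%g. Proof. by []. Qed.
Lemma embN x : emb (- x) = ((emb x)^-1)%g. Proof. by []. Qed.
Lemma emb0 : emb 0 = 1%g. Proof. by []. Qed.
Lemma emb_inj : injective emb. Proof. exact: val_inj. Qed.
Lemma embP x : nsub_set N (emb x). Proof. exact/asboolP/(valP (x : nsub N)). Qed.

Lemma emb_surj h : nsub_set N h -> exists x, emb x = h.
Proof. by move=> /asboolP Nh; exists (exist (nsub_pred N) h Nh). Qed.

Lemma proj_emb h x : proj N (h * emb x)%g = proj N h.
Proof.
have Nx : proj N (emb x) = 1%g by apply/proj_eq1/embP.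
by rewrite projM Nx mulg1.
Qed.

Lemma emb_act h x : emb (act h x) = (h * emb x * h^-1)%g. Proof. by []. Qed.

Lemma act_inner h x : nsub_set N h -> act h x = x.
Proof.
move=> /emb_surj[z <-]; apply: emb_inj; rewrite emb_act -embD.
by rewrite [z + x]addrC embD mulgK.
Qed.

Lemma actM h m x : act (h * m)%g x = act h (act m x).
Proof. by apply: emb_inj; rewrite !emb_act invgM !mulgA. Qed.

Lemma act1 x : act 1%g x = x.
Proof. by apply: emb_inj; rewrite emb_act invg1 mul1g mulg1. Qed.

Lemma actVK h : cancel (act h^-1%g) (act h).
Proof. by move=> x; rewrite -actM mulgV act1. Qed.

Lemma actB h x z : act h (x - z) = act h x - act h z.
Proof.
apply: emb_inj; rewrite embD embN !emb_act embD embN !invgM invgK !mulgA.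
by rewrite mulgVK.
Qed.

Lemma actD h x z : act h (x + z) = act h x + act h z.
Proof. by apply: emb_inj; rewrite embD !emb_act embD !mulgA mulgVK. Qed.

Lemma act_gen h i x : proj N h = g i -> act h x = gX i *: x.
Proof. by move=> hi; rewrite [RHS]polymod_scaleX -hi; apply/esym/conj_act_pi. Qed.

Lemma emb_conj h x : (emb x ^ h)%g = emb (act h^-1%g x).
Proof. by rewrite conjgE emb_act invgK mulgA. Qed.

Lemma comm_emb m x : [~ m, emb x]%g = emb (x - act m^-1%g x).
Proof. by rewrite addrC embD embN -emb_conj commgEr conjVg. Qed.

Lemma comm_in_N h m : exists z, emb z = [~ h, m]%g.
Proof.
apply: emb_surj; apply/proj_eq1; rewrite commgEl conjgE !projM !projV.
set p := proj N h; set q := proj N m.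
have C : commute p q by apply: abQ.
by rewrite [(p * q)%g]C mulKg mulVg.
Qed.

Lemma submod_additive K : K 0 -> (forall x z, K x -> K z -> K (x - z)) ->
  (forall i x, K x -> K (gX i *: x)) -> is_submod K.
Proof.
move=> K0 KB KX; have [KD KM] := subB_closed K0 KB.
apply: mpoly_submod => // c x Kx; rewrite -[c]intz rmorph_int scaler_int.
exact: KM.
Qed.

(** To prove that a subgroup is everything, it suffices to find in it [N] and the
    elements over the chosen generators of the quotient. *)
Lemma proj_induction (P : G -> Prop) :
  (forall h, nsub_set N h -> P h) -> (forall i h, proj N h = g i -> P h) ->
  (forall h m, P h -> P m -> P (h * m^-1)%g) -> forall h, P h.
Proof.
move=> PN Pg PM h.
have := @gen_subgroup_all _ _ [set q : quotg N | forall h, proj N h = q -> P h] gen_g.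
apply=> [|_ [i _ <-] k /Pg //|//].
split=> [k /proj_eq1/PN //|p q Pp Pq k kpq].
have [r rq] : exists r, proj N r = q by exists (repr q); apply: projK.
rewrite -[k](mulgK r); apply: PM; last exact: Pq.
by apply: Pp; rewrite projM rq kpq mulgVK.
Qed.

(** Submodules are stable under the [gX i], but perhaps not under their inverses;
    normality of a subgroup of [N] is the following condition. *)
Definition stable K := forall h x, K (act h x) <-> K x.

Lemma stableP K : is_submod K -> (forall i x, K (gX i *: x) -> K x) -> stable K.
Proof.
move=> sK KX h; move: h.
apply: (@proj_induction (fun h => forall x, K (act h x) <-> K x)).
- by move=> h Nh x; rewrite act_inner.
- move=> i h hi x; rewrite (act_gen _ hi); split; first exact: KX.
  exact: submodZ.
- by move=> h m Kh Km x; rewrite actM Kh -{2}(actVK m x) Km.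
Qed.

(** [gX i] is bijective on [E], so it does not annihilate [E / K] and is injective
    there. *)
Lemma max_stable K : max_submod K -> stable K.
Proof.
move=> maxK; have [sK _ _] := maxK; apply: stableP => // i x.
apply: ann_reg => // KX; have [z Kz] := max_submod_out maxK; apply: Kz.
rewrite -(actVK (repr (g i)) z) (act_gen (i := i)) ?projK //; exact: KX.
Qed.

Section Supplement.
Variable M : set G.
Hypotheses (sM : is_subgroup M) (MN : forall h, exists m x, M m /\ h = (m * emb x)%g).

Definition trace : set E := [set x | M (emb x)].

Lemma over_trace_submod H : is_subgroup H -> M `<=` H ->
  is_submod [set x | H (emb x)].
Proof.
move=> sH MH; apply: submod_additive => /= [|x z Hx Hz|i x Hx].
- by rewrite emb0; apply: subg1.
- by rewrite embD embN; apply: sH.2.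
have [m [z [Mm hE]]] := MN (repr (g i)).
rewrite -(@act_gen (repr (g i))) ?projK // hE actM (act_inner _ (embP z)) emb_act.
by apply: subgM => //; [apply: subgM => // | apply: subgV => //]; apply: MH.
Qed.

Lemma trace_stable : stable trace.
Proof.
move=> h x; have [m [z [Mm ->]]] := MN h; rewrite actM (act_inner _ (embP z)).
rewrite /trace /= emb_act; split=> H.
  rewrite -[emb x](mulKg m) -[(m * emb x)%g](mulgK m^-1%g) invgK.
  by apply: (subgM sM) => //; [apply: (subgV sM)|apply: (subgM sM)].
by apply: (subgM sM) => //; [apply: (subgM sM) | apply: (subgV sM)].
Qed.

Lemma trace_submod : is_submod trace.
Proof. exact: over_trace_submod. Qed.

(** Since [MN = G], each left coset of [M] meets [N]. *)
Lemma trace_index n : has_index M n <-> quot_size trace n.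
Proof.
rewrite (has_indexP sM); have MNl h : exists x, M ((emb x)^-1 * h)%g.
  have [m [z [Mm hE]]] := MN h^-1%g; exists (- z).
  by rewrite embN invgK -[h]invgK hE invgM mulVKg; apply: (subgV sM).
have [c Hc] := choice MNl.
have trE x z : trace (x - z) <-> M ((emb x)^-1 * emb z)%g.
  suff : trace (x - z) <-> trace (- x + z) by [].
  by rewrite [- x + z]addrC; split; exact: (submodBC trace_submod).
split=> -[e [esurj eM]].
  exists (e \o emb); split=> [i|x z] /=; last by rewrite eM trE.
  by have [h <-] := esurj i; exists (c h); apply/eM/Hc.
exists (e \o c); split=> [i|h k] /=.
  have [x <-] := esurj i; exists (emb x); apply/eM/trE/Hc.
rewrite eM trE.
have -> : (h^-1 * k = ((emb (c h))^-1 * h)^-1 * ((emb (c h))^-1 * emb (c k)) *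
    ((emb (c k))^-1 * k))%g.
  by rewrite invgM invgK !mulgA !mulgK.
split=> [Mhk|/(subgMr sM (Hc k))]; last by move/(subgMl sM (subgV sM (Hc h))).
by apply: (subgM sM) => //; apply: (subgM sM) => //; apply: (subgV sM).
Qed.

Lemma trace_mul L : is_submod L -> stable L -> trace `<=` L ->
  is_subgroup [set h | exists m x, [/\ M m, L x & h = (m * emb x)%g]].
Proof.
move=> sL Lst ML; split.
  by exists 1%g, 0; rewrite emb0 mulg1; split=> //; [apply: subg1|apply: submod0].
move=> _ _ [m [x [Mm Lx ->]]] [m' [x' [Mm' Lx' ->]]].
exists (m * m'^-1)%g, (act m' (x - x')); split; first exact: sM.2.
  by apply/Lst; apply: submodB.
by rewrite emb_act embD embN invgM !mulgA mulgVK.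
Qed.

Lemma trace_max_subgroup : max_submod trace -> is_maximal_subgroup M.
Proof.
move=> [_ trT trmax]; split=> // [|H sH MH].
  by apply: contra_neq trT => MT; rewrite /trace MT.
have [L_M|LT] := trmax _ (over_trace_submod sH MH) (fun x => MH (emb x)).
  left; apply/seteqP; split=> // h Hh; have [m [x [Mm hE]]] := MN h.
  rewrite hE; apply: (subgM sM) => //.
  have : [set x | H (emb x)] x.
    by apply: (subgMl sH (MH _ Mm)); rewrite -hE.
  by rewrite L_M.
right; apply/seteqP; split=> // h _; have [m [x [Mm ->]]] := MN h.
apply: (subgM sH) => //; first exact: MH.
by have : [set x | H (emb x)] x by rewrite LT.
Qed.

(** A submodule [L] above the trace must be shown to be stable, so that [M] and [L]
    generate a proper subgroup when [L] is proper. Stability holds because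
    [gX i] acts on the finite set [E / trace] as a permutation, whose inverse on a
    given element is one of its powers. *)
Lemma max_subgroup_trace n : is_maximal_subgroup M -> has_index M n -> max_submod trace.
Proof.
move=> [_ MT Mmax] /trace_index[e [_ eM]]; have str := trace_submod.
split=> // [|L sL trL].
  apply: contra_neq MT => trT; apply/seteqP; split=> // h _.
  have [m [x [Mm ->]]] := MN h; apply: subgM => //.
  by have : trace x by rewrite trT.
have Lst : stable L.
  apply: stableP => // i x LXx.
  pose f (k : 'I_n.+1) := e (gX i ^+ k *: x).
  have [a [b [ab fab]]] : exists a b : 'I_n.+1, (a < b)%N /\ f a = f b.
    have : ~~ injectiveb f.
      apply/negP => /injectiveP/leq_card; by rewrite !card_ord ltnn.
    move=> /injectivePn[a [b ab fab]].
    case: (ltngtP a b) => [lt_ab|lt_ba|/val_inj ab']; first by exists a, b.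
      by exists b, a.
    by rewrite ab' eqxx in ab.
  move/eM: fab; rewrite -(subnK (ltnW ab)) addnC exprD -scalerA -scalerBr.
  have pow k z : trace (gX i ^+ k *: z) -> trace z.
    elim: k => [|k IH]; first by rewrite expr0 scale1r.
    rewrite exprS -scalerA -(@act_gen (repr (g i))) ?projK //.
    by move=> /trace_stable/IH.
  move=> /pow/trL Lx; apply: (submodBr sL Lx).
  by rewrite -(subnSK ab) exprSr -scalerA; apply: (submodZ sL).
have [|HM|HT] := Mmax _ (trace_mul sL Lst trL).
- by move=> m Mm; exists m, 0; rewrite emb0 mulg1; split=> //; apply: submod0.
- left; apply/seteqP; split=> // x Lx; rewrite /trace /= -HM.
  by exists 1%g, x; rewrite mul1g; split=> //; apply: subg1.
right; apply/seteqP; split=> // z _.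
have [m [x [Mm Lx zE]]] : exists m x, [/\ M m, L x & emb z = (m * emb x)%g].
  by have : setT (emb z) by []; rewrite -HT.
apply: submodBr Lx => //; apply: trL; rewrite /trace /= embD embN zE mulgK //.
Qed.

End Supplement.

(** The centralizer of [m] modulo [K]. For [m] over a generator that acts on
    [E / K] nontrivially, it is a complement of [E / K] in [G / K]. *)
Definition centr K m : set G := [set h | exists2 z, K z & [~ m, h]%g = emb z].

Section Centralizer.
Variables (K : set E) (i : 'I_l0) (m : G).
Hypotheses (maxK : max_submod K) (Ki : ~ ann K (gX i - 1)) (mi : proj N m = g i).

Let sK : is_submod K. Proof. by case: maxK. Qed.
Let Kst : stable K. Proof. exact: max_stable. Qed.

(** The commutator with [m] acts on [E / K] as the invertible map
    [gX i - 1], up to an automorphism. *)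
Lemma centr_emb x : centr K m (emb x) <-> K x.
Proof.
rewrite /centr /= comm_emb; split=> [[z Kz /emb_inj zE]|Kx].
  rewrite -zE in Kz; apply: (ann_reg maxK Ki); rewrite scalerBl scale1r.
  by rewrite -(act_gen _ mi); move/(Kst m): Kz; rewrite actB actVK.
by exists (x - act m^-1%g x) => //; apply: submodB => //; apply/Kst.
Qed.

Lemma centr_subgroup : is_subgroup (centr K m).
Proof.
split; first by exists 0; [exact: submod0 | rewrite commg1].
move=> h k [z Kz hE] [w Kw kE].
have kVE : [~ m, k^-1]%g = emb (- act k w).
  rewrite embN emb_act -kE.
  by rewrite !commgEl !conjgE !invgM !invgK !mulgA mulgV mul1g.
exists (- act k w + act k z).
  by apply: submodD => //; [apply: submodN => //|]; apply/Kst.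
rewrite embD -kVE emb_act -hE.
by rewrite !commgEl !conjgE !invgM !invgK !mulgA mulgVK mulgK.
Qed.

(** Invertibility of [gX i - 1] on [E / K] gives [x] such that the commutator of
    [m] with [emb x] cancels the one with [h]. *)
Lemma centr_supplement h : exists k x, centr K m k /\ h = (k * emb x)%g.
Proof.
have [c cE] := comm_in_N m h; have [a Ka] := ann_inv maxK Ki.
pose x := - (a *: (gX i *: c)).
exists (h * emb x)%g, (- x); rewrite embN mulgK; split=> //.
exists (x - act m^-1%g x + c); last first.
  have -> : [~ m, h * emb x]%g = ([~ m, emb x] * ([~ m, h] ^ emb x))%g.
    by rewrite !commgEl !conjgE !invgM !mulgA !mulgK.
  rewrite -cE comm_emb emb_conj (act_inner c); last by rewrite -embN; apply: embP.
  by rewrite -embD.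
apply/(Kst m).
have -> : act m (x - act m^-1%g x + c) = - ((a * (gX i - 1) - 1) *: (gX i *: c)).
  rewrite actD actB actVK !(act_gen _ mi) /x; move: (gX i *: c) => w.
  rewrite [in RHS]scalerBl scale1r opprB addrC; congr (_ + _).
  by rewrite mulrC -scalerA scalerBl scale1r scalerN opprB opprK addrC.
exact (submodN sK (Ka _)).
Qed.

Lemma centr_trace : trace (centr K m) = K.
Proof. by apply/seteqP; split=> x /centr_emb. Qed.

Lemma centr_self : centr K m m.
Proof. by exists 0; [exact: submod0 | rewrite commgg]. Qed.

Lemma centr_max n : quot_size K n ->
  is_maximal_subgroup (centr K m) /\ has_index (centr K m) n.
Proof.
move=> sizeK; have sM := centr_subgroup; have MN := centr_supplement.
split; first by apply: (trace_max_subgroup sM MN); rewrite centr_trace.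
by apply/(trace_index sM MN); rewrite centr_trace.
Qed.

(** Commutators of elements of [M] lie in [M] and in [N], hence in [K]; so [M] is
    contained in the centralizer, and both have trace [K]. *)
Lemma supplement_centr M : is_subgroup M ->
  (forall h, exists k x, M k /\ h = (k * emb x)%g) -> trace M = K -> M m ->
  M = centr K m.
Proof.
move=> sM MN trM Mm; have sC := centr_subgroup.
have MC : M `<=` centr K m.
  move=> h Mh; have [z zE] := comm_in_N m h; exists z => //.
  rewrite -trM /trace /= zE commgEl conjgE.
  by do ![apply: (subgM sM) => // | apply: (subgV sM) => //].
apply/seteqP; split=> // h Ch; have [k [x [Mk hE]]] := MN h.
rewrite hE; apply: (subgM sM) => //.
suff : trace M x by [].
by rewrite trM; apply/centr_emb/(subgMl sC (MC _ Mk)); rewrite -hE.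
Qed.

End Centralizer.

Lemma centr_inj K K' i m x x' :
  max_submod K -> max_submod K' -> ~ ann K (gX i - 1) -> ~ ann K' (gX i - 1) ->
  proj N m = g i -> centr K (m * emb x)%g = centr K' (m * emb x')%g ->
  K = K' /\ K (x - x').
Proof.
move=> maxK maxK' Ki Ki' mi CC.
have mx z : proj N (m * emb z)%g = g i.
  by rewrite proj_emb.
have KK' : K = K'.
  by rewrite -(centr_trace maxK Ki (mx x)) CC (centr_trace maxK' Ki' (mx x')).
split=> //; have sC := centr_subgroup (m * emb x)%g maxK.
apply/(centr_emb maxK Ki (mx x)).
have C1 : centr K (m * emb x)%g (m * emb x)%g by apply: centr_self.
have C2 : centr K' (m * emb x')%g (m * emb x')%g by apply: centr_self.
rewrite -CC in C2.
have := subgM sC (subgV sC C2) C1.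
by rewrite invgM -mulgA mulKg -embN -embD addrC.
Qed.

Lemma centr_eq K i m x x' : max_submod K -> ~ ann K (gX i - 1) ->
  proj N m = g i -> K (x - x') -> centr K (m * emb x)%g = centr K (m * emb x')%g.
Proof.
move=> maxK Ki mi Kxx; have [sK _ _] := maxK.
have mx z : proj N (m * emb z)%g = g i.
  by rewrite proj_emb.
have sC := centr_subgroup (m * emb x)%g maxK.
apply: (supplement_centr maxK Ki (mx x') sC).
- exact: (centr_supplement maxK Ki (mx x)).
- exact: (centr_trace maxK Ki (mx x)).
have -> : (m * emb x' = (m * emb x) * emb (x' - x))%g.
  by rewrite -mulgA -embD addrC subrK.
apply: (subgM sC); first exact: centr_self.
by apply/(centr_emb maxK Ki (mx x)); apply: submodBC.
Qed.

(** If [G] acts trivially on [N / (M :&: N)], then [N] normalizes [M] because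
    commutators with [N] lie in [M]. So [M] is normal, and the image of [N] in
    [G / M] is abelian and everything. *)
Lemma derived_sub_trivial M : is_subgroup M ->
  (forall h, exists k x, M k /\ h = (k * emb x)%g) ->
  (forall i, ann (trace M) (gX i - 1)) -> derived_set G `<=` M.
Proof.
move=> sM MN Mi; have str := trace_submod sM MN.
have st := trace_stable sM MN.
have triv h x : trace M (act h x - x).
  move: h x; apply: proj_induction => [h Nh x|i h hi x|h k IHh IHk x].
  - by rewrite act_inner // subrr; apply: submod0.
  - by have := Mi i x; rewrite scalerBl scale1r (act_gen _ hi).
  rewrite actM -(subrKA (act k^-1%g x)); apply: submodD => //.
  by have /submodBC := IHk (act k^-1%g x); rewrite actVK; apply.
have Mconj k x : M k -> M (k ^ emb x)%g.
  move=> Mk; have -> : (k ^ emb x = k * [~ k, emb x])%g by rewrite commgEl mulVKg.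
  apply: (subgM sM) => //; rewrite comm_emb.
  by apply: (submodBC str); apply: triv.
have MconjG k h : M k -> M (k ^ h)%g.
  move=> Mk; have [a [x [Ma ->]]] := MN h; rewrite conjgM; apply: Mconj.
  by rewrite conjgE; apply: (subgM sM); [apply: subgV|apply: subgM].
apply: smallest_sub => // _ [h [k ->]].
have [a [x [Ma ->]]] := MN h; have [b [z [Mb ->]]] := MN k.
have -> : [~ a * emb x, b * emb z]%g =
   ([~ a, b * emb z] ^ emb x * [~ emb x, b * emb z])%g.
  by rewrite !commgEl !conjgE !invgM !mulgA !mulgK.
apply: (subgM sM).
  apply: Mconj; rewrite commgEl; apply: (subgM sM); first exact: subgV.
  exact: MconjG.
rewrite -[[~ _, _]%g]invgK; apply: subgV => //; rewrite invgR comm_emb.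
exact: (submodBC str).
Qed.

End ConjugationModule.

(** * Counting and growth degree *)

Section Codes.
Variables (T : choiceType) (A : set T) (F : finType).

(** The code is a relation, so that [F] may be empty when [A] is. *)
Lemma card_le_code (code : T -> F -> Prop) :
  (forall x, A x -> exists c, code x c) ->
  (forall x y c, code x c -> code y c -> x = y) ->
  finite_set A /\ (#|` fset_set A|%fset <= #|F|)%N.
Proof.
move=> codeA code_inj.
have [[x0 Ax0]|A0] := pselect (exists x, A x); last first.
  have -> : A = set0 by apply/seteqP; split=> // x Ax; apply: A0; exists x.
  by rewrite fset_set0 cardfs0; split.
have [c0 _] := codeA x0 Ax0.
have /choice[f Hf] x : exists c, A x -> code x c.
  have [/codeA[c xc]|Ax] := pselect (A x); first by exists c.
  by exists c0.
have finj x y : A x -> A y -> f x = f y -> x = y.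
  by move=> /Hf xf /Hf yf fxy; rewrite fxy in xf; apply: code_inj yf.
have finA : finite_set A.
  have /choice[h Hh] c : exists x, forall y, A y -> f y = c -> y = x.
    have [[x [Ax xc]]|H] := pselect (exists x, A x /\ f x = c).
      by exists x => y Ay yc; apply: finj => //; rewrite xc.
    by exists x0 => y Ay yc; case: H; exists y.
  apply: (@sub_finite_set _ _ (h @` [set: F])).
    by move=> x Ax; exists (f x) => //; apply/esym/Hh.
  exact/finite_image/finite_finset.
split=> //; have us : uniq (map f (fset_set A)).
  rewrite map_inj_in_uniq ?fset_uniq // => x z.
  by rewrite !in_fset_set // => /set_mem Ax /set_mem Az; apply: finj.
by rewrite -(size_map f) -(card_uniqP us) max_card.
Qed.

Lemma card_ge_inj (f : F -> T) : finite_set A -> injective f ->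
  (forall c, A (f c)) -> (#|F| <= #|` fset_set A|%fset)%N.
Proof.
move=> finA finj fA; rewrite cardE -(size_map f); apply: uniq_leq_size.
  by rewrite map_inj_uniq ?enum_uniq.
by move=> _ /mapP[c _ ->]; rewrite in_fset_set //; apply/mem_set.
Qed.

End Codes.

Section Degree.
Variables (R : realType) (G : groupType).
Local Notation m_ := (@num_maximal_subgroups G).

Lemma grp_mdeg_le C n0 (b : R) :
  (forall n, (n0 < n)%N -> (m_ n)%:R <= C%:R * n%:R `^ b) ->
  (grp_mdeg G R <= b%:E)%E.
Proof.
move=> mC; apply/lee_addgt0Pr => e e0; rewrite -EFinD.
apply: ereal_inf_lbound; exists (b + e) => //=.
near=> n.
have n1 : (0 < n)%N by near: n; apply: nbhs_infty_gt.
have nR : 0 < n%:R :> R by rewrite ltr0n.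
apply: le_trans (mC n _) _; first by near: n; apply: nbhs_infty_gt.
rewrite powRD; last by apply/implyP => _; rewrite gt_eqF.
rewrite mulrC ler_wpM2l ?powR_ge0 //.
have Cn : C%:R `^ e^-1 < n%:R :> R by near: n; apply: nbhs_infty_gtr.
have -> : C%:R = (C%:R `^ e^-1) `^ e :> R.
  by rewrite -powRrM mulVf ?gt_eqF // powRr1.
apply: ge0_ler_powR; rewrite ?nnegrE ?powR_ge0 //; exact: ltW.
Unshelve. all: by end_near. Qed.

Lemma grp_mdeg_ge (b : R) :
  (forall k, exists2 n, (k < n)%N & n%:R `^ b <= (m_ n)%:R) ->
  (b%:E <= grp_mdeg G R)%E.
Proof.
move=> mb; apply: le_ereal_inf_tmp => _ [a [k _ ka] <-]; rewrite lee_fin leNgt.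
apply/negP => ab; have [n kn bn] := mb (maxn k 1).
have [kn' n1] : (k <= n)%N /\ (1 < n)%N by lia.
have : n%:R `^ b <= n%:R `^ a :> R by apply: le_trans bn (ka n kn').
rewrite leNgt => /negP; apply.
rewrite /powR pnatr_eq0 gtn_eqF ?(ltn_trans _ n1) // ltr_expR ltr_pM2r //.
by rewrite ln_gt0 // ltr1n.
Qed.

End Degree.

(** * Generators of the abelianization *)

Section Quotm.
Variables (R : comNzRingType) (E : lmodType R) (S : set E).
Local Notation Q := (Quotient.quot (span_pred S)).

Definition quotm_proj (x : E) : quotm S := \pi_Q x.

Lemma quotm_projB x z : quotm_proj (x - z) = quotm_proj x - quotm_proj z.
Proof. exact: raddfB. Qed.

Lemma quotm_projD x z : quotm_proj (x + z) = quotm_proj x + quotm_proj z.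
Proof. exact: raddfD. Qed.

Lemma quotm_proj_sum k (v : 'I_k -> E) (c : 'I_k -> int) :
  quotm_proj (\sum_i v i *~ c i) = \sum_i quotm_proj (v i) *~ c i.
Proof. exact/additive_sum/quotm_projD. Qed.

Lemma quotm_projMn x n : quotm_proj (x *+ n) = quotm_proj x *+ n.
Proof. exact: raddfMn. Qed.

Lemma quotm_proj_eq0 x : quotm_proj x = 0 <-> submod_span S x.
Proof.
have := Quotient.idealrBE (span_pred S) x 0.
rewrite subr0 => xE; rewrite -[0](raddf0 \pi_Q); split=> [/eqP|Sx].
  by rewrite -xE => /asboolP.
by apply/eqP; rewrite -xE; apply/asboolP.
Qed.

Lemma submod_span_id (W : set E) : is_submod W -> submod_span W = W.
Proof.
by move=> sW; apply/seteqP; split; [apply: smallest_sub | apply: Defs.sub_span].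
Qed.

Lemma quotm_surj z : exists x, quotm_proj x = z.
Proof. by exists (repr z); apply: reprK. Qed.

Lemma quotm_spans s (y : 'I_s -> E) : Zspans y -> Zspans (fun i => quotm_proj (y i)).
Proof.
move=> yE z; have [x <-] := quotm_surj z; have [c ->] := yE x; exists c.
exact: quotm_proj_sum.
Qed.

End Quotm.

Section GroupData.
Variables (G : groupType) (N : normal_subgroup G).
Hypotheses (abN : abelian_group (nsub N)) (abQ : abelian_group (quotg N)).
Variables (l0 : nat) (g : 'I_l0 -> quotg N).
Hypothesis gen_g : gen_subgroup (range g) = setT.

Local Notation E := (conj_mod abN abQ g).
Local Notation gX i := (mpolyX int (mnm1 i)).
Local Notation IN := (mul_ideal E (aug_ideal l0)).
Implicit Types (x z : E) (h : G).

(** [W] is everything if it contains the images of [N] and of one element over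
    each generator of the quotient. *)
Lemma ab_submod_all (W : set (abelianization G)) : is_submod W ->
  (forall x, W (ab (emb x))) -> (forall i, exists2 h, proj N h = g i & W (ab h)) ->
  forall u, W u.
Proof.
move=> sW WN Wg u; have [h <-] := ab_surj u; move: h.
apply: (proj_induction gen_g) => [h /(emb_surj abN abQ g)[x <-] //|i h hi|h k Wh Wk].
  have [m mi Wm] := Wg i.
  have [x xE] : exists x, emb x = (m^-1 * h)%g.
    by apply: emb_surj; apply/proj_eq; rewrite mi.
  by rewrite -(mulVKg m h) -xE abM; apply: submodD.
by rewrite abM abV; apply: submodB.
Qed.

Lemma ab_embD x z : ab (emb (x + z)) = ab (emb x) + ab (emb z).
Proof. by rewrite embD abM. Qed.

Lemma trivial_act_submod (W : set E) : is_submod W ->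
  (forall i x, W (gX i *: x - x)) -> IN `<=` W.
Proof.
move=> sW WX; apply: smallest_sub => // _ [a [x [Ia ->]]].
move: x; suff : ann W a by [].
apply: Ia; split.
  split=> [|b u v Wu Wv x]; first exact: ann0.
  by rewrite scalerDl -scalerA; apply: submodD => //; apply: submodZ.
by move=> _ [i _ <-] x; rewrite scalerBl scale1r.
Qed.

Lemma IN_trivial h x : IN (act h x - x).
Proof.
have sI : is_submod IN by apply: span_submod.
move: h x; apply: (proj_induction gen_g) => [h Nh x|i h hi x|h k IHh IHk x].
- by rewrite act_inner // subrr; apply: submod0.
- rewrite (act_gen _ hi) -[X in _ - X]scale1r -scalerBl.
  apply: Defs.sub_span; exists (gX i - 1), x; split=> //.
  by apply: Defs.sub_span; exists i.
rewrite actM -(subrKA (act k^-1%g x)); apply: (submodD sI) => //.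
have := IHk (act k^-1%g x); rewrite actVK; exact: (submodBC sI).
Qed.

Lemma ab_IN x : IN x -> ab (emb x) = 0.
Proof.
pose W : set E := [set x | ab (emb x) = 0].
have WX i z : ab (emb (gX i *: z)) = ab (emb z).
  rewrite -(@act_gen _ _ _ _ _ _ (repr (g i))) ?projK // emb_act !abM abV.
  by rewrite addrC addKr.
suff : IN `<=` W by apply.
apply: trivial_act_submod => [|i z].
  apply: submod_additive => [|z w /= Wz Ww|i z /= Wz]; first by rewrite /W /= emb0.
    by rewrite /W /= ab_embD embN abV Wz Ww subrr.
  by rewrite /W /= WX.
by rewrite /W /= ab_embD embN abV WX subrr.
Qed.

Variables (s : nat) (y : 'I_s -> E).
Hypothesis y_spans : Zspans y.

Lemma ab_spans : exists k (v : 'I_k -> abelianization G), Zspans v.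
Proof.
exists (l0 + s)%N; exists (fun j : 'I_(l0 + s) => match fintype.split j with
  | inl i => ab (repr (g i)) | inr i => ab (emb (y i)) end).
set v := fun j => _; have sv := lincomb_submod v.
suff H u : lincomb v u.
  move=> u; have [c ->] := H u; exists c.
  by apply: eq_bigr => i _; rewrite scalezrE.
move: u; apply: ab_submod_all => // [x|i].
  have [c ->] := y_spans x.
  rewrite (additive_sum ab_embD).
  apply: (submod_sum sv) => j _; apply: (submodMz sv).
  have := lincomb_gen v (rshift l0 j); rewrite {2}/v.
  by case: split_ordP => // [i /eqP|i /rshift_inj-> //]; rewrite eq_rlshift.
exists (repr (g i)); first exact: projK.
have := lincomb_gen v (lshift s i); rewrite {2}/v.
by case: split_ordP => // [j /lshift_inj<- //|j /eqP]; rewrite eq_lrshift.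
Qed.

Section Ranks.
Variables (l t : nat).
Hypotheses (rank_l : is_tf_rank (addg abQ) l) (rank_t : is_tf_rank (quotm IN) t).

Lemma IN_rank : exists (w : 'I_t -> E) D, [/\ (0 < D)%N,
  Zfree (fun i => quotm_proj IN (w i) : quotm IN) &
  forall x, exists c : 'I_t -> int, IN (x *+ D - \sum_i w i *~ c i)].
Proof.
have [v [vfree [D D0 vD]]] := tf_rank_span (quotm_spans (S := IN) y_spans) rank_t.
have /choice[w wv] i : exists x, quotm_proj IN x = v i by apply: quotm_surj.
exists w, D; split=> // [|x]; first by rewrite (funext wv).
have [c xc] := vD (quotm_proj IN x); exists c.
have sI : is_submod IN by apply: span_submod.
rewrite -(submod_span_id sI).
apply/quotm_proj_eq0; rewrite quotm_projB quotm_projMn xc quotm_proj_sum.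
by rewrite [X in _ - X](eq_bigr (fun i => v i *~ c i)) ?subrr // => i _; rewrite wv.
Qed.

(** The family consists of lifts of a maximal free family of the quotient and of
    one of [N / IN]. It is free in the split case because there are two
    homomorphisms out of the abelianization, to the quotient and to [N / IN],
    the second one sending an element to its component in [N]. *)
Lemma ab_rank : exists (v : 'I_(l + t) -> abelianization G) D, [/\ (0 < D)%N,
  forall u, lincomb v (D%:R *: u) & splits N -> Zfree v].
Proof.
have [q [qfree [D0 D0_gt0 qD]]] := tf_rank_span (Zspans_gen (abA := abQ) gen_g) rank_l.
have [w [D1 [D1_gt0 wfree wD]]] := IN_rank.
pose vf (j : 'I_l + 'I_t) : abelianization G := match j with
  | inl i => ab (repr (q i)) | inr i => ab (emb (w i)) end.
pose v j := vf (fintype.split j).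
have vl i : v (lshift t i) = ab (repr (q i)).
  by rewrite /v -[lshift t i]/(unsplit (inl i)) unsplitK.
have vr i : v (rshift l i) = ab (emb (w i)).
  by rewrite /v -[rshift l i]/(unsplit (inr i)) unsplitK.
have sv := lincomb_submod v; have siv := isolator_submod sv.
have [p pD pE] := ab_lift (f := proj N : G -> addg abQ) (@projM G N).
have vwD x : lincomb v (ab (emb x) *+ D1).
  have [c /ab_IN] := wD x.
  rewrite (additive_mapB ab_embD) (additive_mapMn ab_embD) (additive_sum ab_embD).
  move=> /subr0_eq->; apply: (submod_sum sv) => i _; apply: (submodMz sv).
  by rewrite -vr; apply: lincomb_gen.
have Wv u : isolator (lincomb v) u.
  move: u; apply: ab_submod_all => // [x|i].
    by exists D1; rewrite ?scaler_nat.
  exists (repr (g i)); first exact: projK.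
  have [c gc] := qD (g i).
  pose u := ab (repr (g i)) *+ D0 - \sum_j ab (repr (q j)) *~ c j.
  have [x ux] : exists x, u = ab (emb x).
    have [h uh] := ab_surj u.
    have : p (ab h) = 0.
      rewrite uh (additive_mapB pD) (additive_mapMn pD) (additive_sum pD).
      under eq_bigr do rewrite pE projK.
      by rewrite pE projK gc subrr.
    rewrite pE => /proj_eq1/(emb_surj abN abQ g)[x xh].
    by exists x; rewrite xh uh.
  exists (D1 * D0)%N; first by rewrite muln_gt0 D1_gt0.
  rewrite natrM -scalerA !scaler_nat -(subrK (\sum_j ab (repr (q j)) *~ c j) (_ *+ D0)).
  rewrite mulrnDl -/u ux; apply: (submodD sv) => //.
  rewrite -scaler_nat; apply: (submodZ sv); apply: (submod_sum sv) => j _.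
  by apply: (submodMz sv); rewrite -vl; apply: lincomb_gen.
have [k [y' y'_spans]] := ab_spans.
have [D D_gt0 HD] := isolator_uniform y'_spans sv (fun i => Wv (y' i)).
exists v, D; split=> // -[sec secM secK] c c0.
have secP q' : proj N (sec q') = q' by apply: secK.
have sec1 : sec 1%g = 1%g by apply: (mulgI (sec 1%g)); rewrite -secM !mulg1.
(* The component [r h] in [N] is not multiplicative in [h], but becomes so modulo
   [IN], where [G] acts trivially. *)
have /choice[r rE] h : exists x : E, emb x = (h * (sec (proj N h))^-1)%g.
  apply/emb_surj/proj_eq1; rewrite projM projV.
  by rewrite secP mulgV.
have r_emb x : r (emb x) = x.
  apply: emb_inj; rewrite rE (_ : proj N (emb x) = 1%g); last exact/proj_eq1/embP.
  by rewrite sec1 invg1 mulg1.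
have rM h k' : quotm_proj IN (r (h * k')%g) =
    quotm_proj IN (r h) + quotm_proj IN (r k') :> quotm IN.
  have -> : r (h * k')%g = r h + act (sec (proj N h)) (r k').
    apply: emb_inj; rewrite embD emb_act !rE projM secM invgM !mulgA.
    by rewrite mulgVK.
  rewrite quotm_projD; congr (_ + _); apply: subr0_eq; rewrite -quotm_projB.
  apply/quotm_proj_eq0; rewrite submod_span_id; last exact: span_submod.
  exact: IN_trivial.
have [pt ptD ptE] := ab_lift rM.
have cl i : c (lshift t i) = 0.
  move: i; apply: (qfree (fun i => c (lshift t i))); have := congr1 p c0.
  rewrite (additive_sum pD) (additive_map0 pD) big_split_ord /=.
  have -> : \sum_(j < t) p (v (rshift l j)) *~ c (rshift l j) = 0.
    apply: big1 => j _; have pw : p (ab (emb (w j))) = 0.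
      by rewrite pE; apply/proj_eq1/embP.
    by rewrite vr pw mul0rz.
  by rewrite addr0; under eq_bigr do rewrite vl pE projK.
have cr i : c (rshift l i) = 0.
  move: i; apply: (wfree (fun i => c (rshift l i))); have := congr1 pt c0.
  rewrite (additive_sum ptD) (additive_map0 ptD) big_split_ord /=.
  have -> : \sum_(j < l) pt (v (lshift t j)) *~ c (lshift t j) = 0.
    by apply: big1 => j _; rewrite cl mulr0z.
  by rewrite add0r; under eq_bigr do rewrite vr ptE r_emb.
by move=> j; case: (split_ordP j) => i ->.
Qed.

End Ranks.
End GroupData.

(** * The maximal subgroup growth of the extension *)

Section Count.
Variables (G : groupType) (N : normal_subgroup G).
Hypotheses (abN : abelian_group (nsub N)) (abQ : abelian_group (quotg N)).
Variables (l0 : nat) (g : 'I_l0 -> quotg N).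
Hypothesis gen_g : gen_subgroup (range g) = setT.

Local Notation E := (conj_mod abN abQ g).
Local Notation gX i := (mpolyX int (mnm1 i)).
Local Notation IN := (mul_ideal E (aug_ideal l0)).

Lemma max_subgroup_supplement (M : set G) : is_maximal_subgroup M ->
  ~ derived_set G `<=` M -> forall h, exists k (x : E), M k /\ h = (k * emb x)%g.
Proof.
move=> [sM MT Mmax] MD.
pose H := [set h | exists k (x : E), M k /\ h = (k * emb x)%g].
have MH : M `<=` H by move=> m Mm; exists m, 0; rewrite emb0 mulg1.
have NH h : nsub_set N h -> H h.
  move=> /(emb_surj abN abQ g)[x <-]; exists 1%g, x; rewrite mul1g.
  by split=> //; apply: subg1.
have sH : is_subgroup H.
  split; first by apply: MH; apply: subg1.
  move=> _ _ [k [x [Mk ->]]] [k' [x' [Mk' ->]]].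
  exists (k * k'^-1)%g, (act k' (x - x')); split; first exact: sM.2.
  by rewrite emb_act embD embN invgM !mulgA mulgVK.
have [HM|HT] := Mmax H sH MH; last by move=> h; have : setT h by []; rewrite -HT.
case: MD; apply: smallest_sub => // _ [h [k ->]]; rewrite -HM.
by have [z <-] := comm_in_N abN abQ g h k; apply/NH/embP.
Qed.

Section Upper.
Variables (s1 k D1 : nat) (y1 : 'I_s1 -> abelianization G).
Variable v1 : 'I_k -> abelianization G.
Hypotheses (y1_spans : Zspans y1) (D1_gt0 : (0 < D1)%N)
  (v1D : forall u, lincomb v1 (D1%:R *: u)).
Variables (s2 d D2 : nat) (y2 : 'I_s2 -> E) (v2 : 'I_d -> E).
Hypotheses (y2_spans : Zspans y2) (D2_gt0 : (0 < D2)%N)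
  (v2D : forall x, lincomb v2 (D2%:R *: x)).

(** A subgroup over the derived subgroup is coded by a maximal submodule of the
    abelianization; another one by a maximal submodule [K] of [E], an index [i]
    such that [gX i - 1] does not annihilate [E / K], and the class modulo [K] of
    the [x] such that it contains [repr (g i) * emb x]. *)
Lemma count_max_subgroups n : (1 < n)%N -> (D1 ^ s1 < n)%N -> (D2 ^ s2 < n)%N ->
  finite_set (maximal_subgroups (G := G) n) /\
  (num_maximal_subgroups G n <=
     s1 * k * n ^ k.-1 + s2 * d * n ^ d.-1 * l0 * n)%N.
Proof.
move=> n1 nD1 nD2.
have [code1 [code1_ex code1_inj]] := max_submod_code y1_spans v1D n1.
have [code2 [code2_ex code2_inj]] := max_submod_code y2_spans v2D n1.
have /choice[enc encP] (K : set E) :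
    exists e : E -> 'I_n, quot_size K n -> quot_enum K e.
  have [[e eK]|H] := pselect (quot_size K n); first by exists e.
  by exists (fun=> Ordinal (ltnW n1)) => /H.
pose F : finType := (('I_s1 * 'I_k * {ffun 'I_k.-1 -> 'I_n}) +
           ('I_s2 * 'I_d * {ffun 'I_d.-1 -> 'I_n}) * 'I_l0 * 'I_n)%type.
pose code (M : set G) (c : F) : Prop := match c with
  | inl c1 => exists2 K, M = ab_preim K & code1 K c1
  | inr (c2, i, z) => exists K x, [/\ max_submod K, quot_size K n,
      ~ ann K (gX i - 1), M = centr K (repr (g i) * emb x)%g &
      enc K x = z /\ code2 K c2]
  end.
have -> : (s1 * k * n ^ k.-1 + s2 * d * n ^ d.-1 * l0 * n = #|F|)%N.
  by rewrite card_sum !card_prod !card_ffun !card_ord.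
apply: (card_le_code (code := code)) => [M [maxM indM]|M M' [c1|[[c2 i] z]]].
- have [sM _ _] := maxM.
  have [DM|DM] := pselect (derived_set G `<=` M).
    have [K sK ME] := ab_preim_exists sM DM; rewrite ME in maxM indM.
    have maxK : max_submod K by apply/ab_preim_max.
    have sizeK : quot_size K n by apply/ab_preim_index.
    have [|c Kc] := code1_ex K maxK sizeK.
      by move/(quot_size_le y1_spans sK sizeK D1_gt0); rewrite leqNgt nD1.
    by exists (inl c), K.
  have MN := max_subgroup_supplement maxM DM.
  have maxK := max_subgroup_trace gen_g sM MN maxM indM.
  have [sK _ _] := maxK.
  have sizeK := (trace_index sM MN n).1 indM.
  have [i Ki] : exists i, ~ ann (@trace _ _ abN abQ _ g M) (gX i - 1).
    apply/existsNP => H; apply: DM; exact: (derived_sub_trivial gen_g sM MN H).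
  have [c Kc] : exists c, code2 (trace M) c.
    apply: code2_ex => //.
    by move/(quot_size_le y2_spans sK sizeK D2_gt0); rewrite leqNgt nD2.
  have [m [x [Mm mE]]] := MN (repr (g i)).
  exists (inr (c, i, enc (trace M) (- x))), (trace M), (- x); split=> //.
  have mE' : m = (repr (g i) * emb (- x))%g by rewrite embN mE mulgK.
  rewrite mE' in Mm; apply: (supplement_centr gen_g maxK Ki _ sM MN _ Mm) => //.
  by rewrite proj_emb projK.
- by move=> [K -> Kc] [K' -> Kc']; rewrite (code1_inj _ _ _ Kc Kc').
move=> [K [x [maxK sizeK Ki -> [xz Kc]]]] [K' [x' [_ _ _ -> [xz' Kc']]]].
have KK' := code2_inj _ _ _ Kc Kc'; rewrite -KK' in xz' *.
apply: (centr_eq gen_g maxK Ki); first exact: projK.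
by have [_ eK] := encP K sizeK; apply/eK; rewrite xz.
Qed.

End Upper.

Lemma count_ab_max k n (K : {ffun 'I_k -> 'I_n} -> set (abelianization G)) :
  finite_set (maximal_subgroups (G := G) n) -> injective K ->
  (forall f, max_submod (K f) /\ quot_size (K f) n) ->
  (n ^ k <= num_maximal_subgroups G n)%N.
Proof.
move=> fin Kinj KP; rewrite (_ : n ^ k = #|{ffun 'I_k -> 'I_n}|)%N; last first.
  by rewrite card_ffun !card_ord.
apply: (card_ge_inj (f := fun f => ab_preim (K f)) fin).
  by move=> f f' /ab_preim_inj/Kinj.
move=> f; have [maxK sizeK] := KP f; have [sK _ _] := maxK.
by split; [apply/ab_preim_max | apply/ab_preim_index].
Qed.

(** Each maximal submodule [K f] has [n] complements, the centralizers. *)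
Lemma count_centr k n i (K : {ffun 'I_k -> 'I_n} -> set E) :
  finite_set (maximal_subgroups (G := G) n) -> injective K ->
  (forall f, [/\ max_submod (K f), ~ ann (K f) (gX i - 1) & quot_size (K f) n]) ->
  (n ^ k.+1 <= num_maximal_subgroups G n)%N.
Proof.
move=> fin Kinj KP.
rewrite (_ : n ^ k.+1 = #|(({ffun 'I_k -> 'I_n} * 'I_n)%type : finType)|)%N;
  last first.
  by rewrite card_prod card_ffun !card_ord expnSr.
have /choice[r Hr] f : exists r : 'I_n -> E, forall u v, K f (r u - r v) -> u = v.
  have [_ _ [e [esurj eK]]] := KP f; have [r er] := choice esurj.
  by exists r => u v /eK; rewrite !er.
pose M (fz : {ffun 'I_k -> 'I_n} * 'I_n) :=
  centr (K fz.1) (repr (g i) * emb (r fz.1 fz.2))%g.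
apply: (card_ge_inj (f := M) fin); rewrite /M.
  move=> [f u] [f' u'] /=.
  have [maxK Ki _] := KP f; have [maxK' Ki' _] := KP f'.
  move=> /(centr_inj gen_g maxK maxK' Ki Ki' (projK _))[/Kinj ff'].
  by rewrite ff' => /Hr ->.
move=> [f u] /=; have [maxK Ki sizeK] := KP f.
apply: (centr_max gen_g maxK Ki _ sizeK).
by rewrite proj_emb projK.
Qed.

(** If all [gX i - 1] annihilated [E / K], then [E / mE], with [m = ann K], would
    be a quotient of [E / (IN + pE)], and the [w i] would generate it. *)
Lemma nontrivial_gen t (w : 'I_t -> E) D p k (K : set E) : (t <= k)%N ->
  (forall x, exists c : 'I_t -> int, IN (x *+ D - \sum_i w i *~ c i)) ->
  coprime D p -> (0 < D)%N -> max_submod K -> ann K p%:R -> nongen k (ann_mul K) ->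
  exists i, ~ ann K (gX i - 1).
Proof.
move=> tk wD Dp D_gt0 maxK Kp ng; apply/existsNP => KX.
have sA := ann_mul_submod K; have sw := lincomb_submod w.
have sT := add_submodP sw sA.
have IA : IN `<=` ann_mul K.
  apply: trivial_act_submod => // i x.
  by rewrite -[X in _ - X]scale1r -scalerBl; apply: ann_mul_gen; exact: KX.
have [x] := nongen_le tk ng w; apply.
have [[u v] /= uv] := coprimeP _ D_gt0 Dp.
have -> : x = (u * D - v * p)%N%:R *: x by rewrite uv scale1r.
rewrite natrB; last by rewrite leqNgt -subn_gt0; lia.
rewrite scalerBl !natrM -!scalerA; apply: (submodB sT); apply: (submodZ sT).
  have [c /IA xc] := wD x; rewrite scaler_nat; apply: (submodBr sT).
    exact: (add_submodr sw xc).
  apply: (add_submodl sA); apply: (submod_sum sw) => i _; apply: (submodMz sw).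
  exact: lincomb_gen.
by apply: (add_submodr sw); apply: ann_mul_gen.
Qed.

End Count.

(** By the determinant trick, [k] generators modulo [p] would span a subgroup of
    finite index, which cannot contain multiples of [k + 1] free elements. *)
Lemma nongen_free (A : lmodType int) s (y : 'I_s -> A) k (v : 'I_k.+1 -> A) p :
  Zspans y -> Zfree v -> (1 < p)%N -> nongen k [set p%:R *: z | z in [set: A]].
Proof.
move=> y_spans vfree p1 w; apply: contrapT => /forallNP H.
have [|D D0 HD] := isolator_mod y_spans (lincomb_submod w) p1.
  by move=> x; apply: contrapT; apply: H.
suff : (k.+1 <= k)%N by rewrite ltnn.
apply: (Zfree_le (w := w) D0 vfree) => j.
have [c Hc] := HD (v j); exists c; rewrite -scaler_nat Hc.
by apply: eq_bigr => i _; rewrite -{1}(intz (c i)) scaler_int.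
Qed.

Theorem theorem81 (R : realType) (G : groupType) (N : normal_subgroup G)
    (abN : abelian_group (nsub N)) (fgN : fg_group (nsub N))
    (abQ : abelian_group (quotg N))
    (l0 l t d : nat) (g : 'I_l0 -> quotg N)
    (gen_g : gen_subgroup (range g) = setT)
    (rank_l : is_tf_rank (addg abQ) l)
    (rank_t :
      is_tf_rank (quotm (mul_ideal (conj_mod abN abQ g) (aug_ideal l0))) t)
    (gens_d : is_min_gens (rat_mod (conj_mod abN abQ g)) d) :
  (grp_mdeg G R <= (Num.max (l%:R + t%:R - 1) d%:R)%:E)%E /\
  (splits N -> (1 <= l)%N ->
     grp_mdeg G R = (Num.max (l%:R + t%:R - 1) d%:R)%:E).
Proof.
set b := Num.max _ _.
have [s2 [y2 y2_spans]] : exists s (y : 'I_s -> conj_mod abN abQ g), Zspans y.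
  have [s gen_s] := fgN; exists (size s), (tnth (in_tuple s)).
  apply: (Zspans_gen (abA := abN)); rewrite -gen_s; congr gen_subgroup.
  apply/seteqP; split=> x /=; first by move=> [i _ <-]; apply: mem_tnth.
  by move=> /(tnthP (in_tuple s))[i ->]; exists i.
have [v2 [D2 [D2_gt0 v2D]]] := rat_gens y2_spans gens_d.
have [s1 [y1 y1_spans]] := ab_spans gen_g y2_spans.
have [v1 [D1 [D1_gt0 v1D v1free]]] := ab_rank gen_g y2_spans rank_l rank_t.
(* Beyond [n0], no annihilator of a quotient of size [n] contains [D1] or [D2]. *)
pose n0 := (D1 ^ s1 + D2 ^ s2 + 1)%N.
have count n : (n0 < n)%N -> finite_set (maximal_subgroups (G := G) n) /\
    (num_maximal_subgroups G n <=
      s1 * (l + t) * n ^ (l + t).-1 + s2 * d * n ^ d.-1 * l0 * n)%N.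
  rewrite /n0 => nn0.
  by apply: (count_max_subgroups gen_g y1_spans D1_gt0 v1D y2_spans D2_gt0 v2D); lia.
have upper : (grp_mdeg G R <= b%:E)%E.
  apply: (@grp_mdeg_le R G (s1 * (l + t) + s2 * d * l0) n0) => n nn0.
  have [_ le_mn] := count n nn0.
  have n_ge1 : 1 <= n%:R :> R by rewrite ler1n; lia.
  have pow j : j%:R <= b -> n%:R ^+ j <= n%:R `^ b :> R.
    by move=> jb; rewrite -powR_mulrn ?ler_powR // ltW // ltr0n; lia.
  apply: (@le_trans _ _ (_%:R)); first by rewrite ler_nat; apply: le_mn.
  rewrite !natrD mulrDl lerD //.
    case: (l + t)%N (natrD R l t) => [|j] jE; first by rewrite muln0 mul0n !mul0r.
    rewrite natrM natrX ler_wpM2l // pow // le_max; apply/orP; left.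
    by rewrite -jE -natr1 addrK.
  case: d @b pow {gens_d v2 v2D le_mn count} => [|j] b pow.
    by rewrite muln0 !mul0n !mul0r.
  rewrite -mulnA -!mulnA [(n ^ _ * _)%N]mulnCA -expnSr !mulnA natrM natrX.
  by rewrite ler_wpM2l // pow // le_max lexx orbT.
split=> // spl l1; apply/eqP; rewrite eq_le upper /=.
have lower1 : ((l%:R + t%:R - 1)%:E <= grp_mdeg G R)%E.
  apply: grp_mdeg_ge => q.
  have [j jE] : exists j, (l + t = j.+1)%N by exists (l + t).-1; lia.
  have [p pq p_pr] := prime_above (n0 + q).
  move: (v1) (v1free spl); rewrite jE => v vfree.
  have ng := nongen_free y1_spans vfree (prime_gt1 p_pr).
  have [K0 [n [_ _ _ pn [K [Kinj KP]]]]] := many_max_submods_prime y1_spans p_pr ng.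
  exists n; first by lia.
  have [|fin _] := count n; first by lia.
  rewrite -natrD jE -natr1 addrK powR_mulrn // -natrX ler_nat.
  by apply: (count_ab_max fin Kinj) => f; have [] := KP f.
rewrite /b EFin_max ge_max lower1 /=.
(* If [d <= t], the bound [l + t - 1] is already at least [d]. *)
have [td|dt] := ltnP t d; last first.
  apply: le_trans lower1; rewrite lee_fin -natrD lerBrDr natr1 ler_nat; lia.
have [w [D [D_gt0 _ wD]]] := IN_rank y2_spans rank_t.
apply: grp_mdeg_ge => q.
have [k dE] : exists k, d = k.+1 by exists d.-1; lia.
rewrite dE in gens_d *; have [p pq p_pr] := prime_above (n0 + q + D).
have ng := rat_nongen y2_spans (prime_gt1 p_pr) gens_d.
have [K0 [n [maxK0 K0p ngK0 pn [K [Kinj KP]]]]] :=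
  many_max_submods_prime y2_spans p_pr ng.
have Dp : coprime D p.
  by rewrite coprime_sym prime_coprime // gtnNdvd //; lia.
have tk : (t <= k)%N by lia.
have [i Ki] := nontrivial_gen tk wD Dp D_gt0 maxK0 K0p ngK0.
exists n; first by lia.
have [|fin _] := count n; first by lia.
rewrite powR_mulrn // -natrX ler_nat.
apply: (count_centr (i := i) gen_g fin Kinj) => f.
by have [maxK annK sizeK] := KP f; split=> //; rewrite annK.
Qed.
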